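(* Let $d\ge 2$ be an integer, let $A,B\in\mathbb{Q}[z]$ with $B\neq 0$, and let $f(z)\in\mathbb{Q}((z^{-1}))$ be a Laurent series which is not a rational function and satisfies $$f(z)=\frac{A(z)}{B(z)}\,f(z^d).$$ Let $f(z)=[a_0(z),a_1(z),a_2(z),\ldots]$ be its (infinite) continued fraction expansion with $a_i\in\mathbb{Q}[z]$, let $p_k(z)/q_k(z)=[a_0(z),\ldots,a_k(z)]$ be its $k$-th convergent with $p_k,q_k$ coprime, and let $d_k=\deg q_k$. Let $b\in\mathbb{Z}$ with $|b|\ge 2$ lie inside the domain of convergence of $f$, and assume $A(b^{d^m})B(b^{d^m})\neq 0$ for every integer $m\ge 0$. Then $$\mu(f(b))=1+\limsup_{k\to\infty}\frac{d_{k+1}}{d_k}.$$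
   Context: The irrationality exponent $\mu(\xi)$ of a real number $\xi$ is the supremum of the real numbers $\mu$ such that $|\xi-p/q|<q^{-\mu}$ has infinitely many rational solutions $p/q$. A Laurent series in $z^{-1}$ converges on a region $|z|>R$; ''inside the domain of convergence'' means $b$ lies in this region. *)

(* Defs.v *)
From HB Require Import structures.
From mathcomp Require Import all_boot all_order all_algebra.
From mathcomp Require Import all_classical all_reals all_analysis.
From mathcomp Require Import zify.

Set Implicit Arguments.
Unset Strict Implicit.
Unset Printing Implicit Defensive.

Import Order.TTheory GRing.Theory Num.Theory.
Import numFieldNormedType.Exports.

Local Open Scope classical_set_scope.
Local Open Scope ring_scope.

Definition bounded_above_by (K : fieldType) (c : int -> K) (N : int) : Prop :=
  forall n : int, N < n -> c n = 0.

(* The field K((z^-1)): [c n] is the coefficient of z^n, and only finitely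
   many positive powers of z occur. *)
Record laurent (K : fieldType) := Laurent {
  lcoef :> int -> K;
  lcoef_bounded : exists N : int, bounded_above_by lcoef N }.

Section LaurentField.
Variable K : fieldType.
Implicit Types f g h : laurent K.

HB.instance Definition _ := gen_eqMixin (laurent K).
HB.instance Definition _ := gen_choiceMixin (laurent K).

Lemma laurentP f g : (forall n, f n = g n) -> f = g.
Proof.
case: f g => [f hf] [g hg] /= /funext fg; case: _ / fg in hg *.
by congr Laurent; exact: Prop_irrelevance.
Qed.

Lemma poly_laurent_bounded (p : {poly K}) :
  exists N, bounded_above_by
    (fun n : int => if n is Posz k then p`_k else 0) N.
Proof.
by exists (size p)%:Z => -[k|//] kp; rewrite nth_default//; apply: ltnW.
Qed.

Definition poly_laurent (p : {poly K}) : laurent K :=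
  Laurent (poly_laurent_bounded p).

Lemma ladd_bounded f g : exists N, bounded_above_by (fun n => f n + g n) N.
Proof.
have [N hN] := lcoef_bounded f; have [M hM] := lcoef_bounded g.
by exists (Num.max N M) => n; rewrite gt_max => /andP[Nn Mn]; rewrite hN ?hM ?addr0.
Qed.

Definition ladd f g := Laurent (ladd_bounded f g).

Lemma lopp_bounded f : exists N, bounded_above_by (fun n => - f n) N.
Proof. by have [N hN] := lcoef_bounded f; exists N => n Nn; rewrite hN ?oppr0. Qed.

Definition lopp f := Laurent (lopp_bounded f).

Lemma laddA : associative ladd.
Proof. by move=> f g h; apply/laurentP => n /=; rewrite addrA. Qed.
Lemma laddC : commutative ladd.
Proof. by move=> f g; apply/laurentP => n /=; rewrite addrC. Qed.
Lemma ladd0 : left_id (poly_laurent 0) ladd.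
Proof. by move=> f; apply/laurentP => -[n|n] /=; rewrite ?coef0 add0r. Qed.
Lemma laddN : left_inverse (poly_laurent 0) lopp ladd.
Proof. by move=> f; apply/laurentP => -[n|n] /=; rewrite ?coef0 addNr. Qed.

HB.instance Definition _ :=
  GRing.isZmodule.Build (laurent K) laddA laddC ladd0 laddN.

(* Cauchy product; the sum over all integers has finite support. *)
Definition conv (f g : int -> K) (n : int) : K :=
  \sum_(i \in [set: int]) f i * g (n - i).

Lemma conv_gt (f g : int -> K) N M :
  bounded_above_by f N -> bounded_above_by g M ->
  bounded_above_by (conv f g) (N + M).
Proof.
move=> fN gM n NMn; apply: fsbig1 => i _.
have [iN|Ni] := leP i N; last by rewrite fN ?mul0r.
by rewrite gM ?mulr0//; lia.
Qed.

Lemma convE (f g : int -> K) N M (k : nat) :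
  bounded_above_by f N -> bounded_above_by g M ->
  conv f g (N + M - k%:Z) =
  \sum_(i < k.+1) f (N - (i : nat)%:Z) * g (M - (k - i)%N%:Z).
Proof.
move=> fN gM.
rewrite /conv (fsbigE [seq N - i%:Z | i <- iota 0 k.+1])//; last 2 first.
- by rewrite map_inj_uniq ?iota_uniq// => i j; lia.
- move=> i _ ir; have [iN|Ni] := leP i N; last by rewrite fN ?mul0r.
  have iE : i = N - `|N - i|%N%:Z by lia.
  have [ki|ik] := leqP `|N - i|%N k.
    by case/negP: ir; apply/mapP; exists `|N - i|%N => //; rewrite mem_iota; lia.
  by rewrite gM ?mulr0//; lia.
have -> : iota 0 k.+1 = index_iota 0 k.+1 by rewrite /index_iota subn0.
rewrite big_map -(big_mkord xpredT (fun i => f (N - i%:Z) * g (M - (k - i)%N%:Z))).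
rewrite big_seq_cond [RHS]big_seq_cond; apply: congr_big => //.
  by move=> i; rewrite in_setT !andbT.
move=> i; rewrite mem_index_iota => /andP[/andP[_ ik] _].
by congr (_ * g _); lia.
Qed.

Definition ltrunc (f : int -> K) (N : int) (m : nat) : {poly K} :=
  \poly_(i < m.+1) f (N - i%:Z).

Lemma conv_trunc (f g : int -> K) N M (k m : nat) :
  bounded_above_by f N -> bounded_above_by g M -> (k <= m)%N ->
  conv f g (N + M - k%:Z) = (ltrunc f N m * ltrunc g M m)`_k.
Proof.
move=> fN gM km; rewrite convE// coefM; apply: eq_bigr => i _.
by rewrite !coef_poly !ifT//; move: (ltn_ord i); lia.
Qed.

Lemma lmul_bounded f g : exists N, bounded_above_by (conv f g) N.
Proof.
have [N hN] := lcoef_bounded f; have [M hM] := lcoef_bounded g.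
by exists (N + M); exact: conv_gt.
Qed.

Definition lmul f g := Laurent (lmul_bounded f g).

Lemma eq_bounded (f g : int -> K) N :
  bounded_above_by f N -> bounded_above_by g N ->
  (forall k : nat, f (N - k%:Z) = g (N - k%:Z)) -> forall n, f n = g n.
Proof.
move=> fN gN fg n; have [nN|Nn] := leP n N; last by rewrite fN ?gN.
have -> : n = N - `|N - n|%N%:Z by lia.
exact: fg.
Qed.

Lemma lmulC : commutative lmul.
Proof.
move=> f g; apply/laurentP.
have [N hN] := lcoef_bounded f; have [M hM] := lcoef_bounded g.
apply: (@eq_bounded _ _ (N + M)); [exact: conv_gt|by rewrite addrC; exact: conv_gt|].
move=> k /=; rewrite (@conv_trunc _ _ _ _ _ k)// mulrC.
by rewrite [N + M]addrC (@conv_trunc _ _ _ _ _ k).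
Qed.

Lemma lmulA : associative lmul.
Proof.
move=> f g h; apply/laurentP.
have [N hN] := lcoef_bounded f; have [M hM] := lcoef_bounded g.
have [P hP] := lcoef_bounded h.
have fgb := conv_gt hN hM; have ghb := conv_gt hM hP.
apply: (@eq_bounded _ _ (N + M + P)).
- by rewrite -addrA; exact: conv_gt.
- exact: conv_gt.
move=> k /=; rewrite -[in LHS](addrA N M P) (convE k hN ghb) (convE k fgb hP).
transitivity ((ltrunc f N k * (ltrunc g M k * ltrunc h P k))`_k).
  rewrite coefM; apply: eq_bigr => i _; rewrite coef_poly ltn_ord.
  by rewrite (@conv_trunc _ _ _ _ _ k)// leq_subr.
rewrite mulrA coefM; apply: eq_bigr => i _.
rewrite (@conv_trunc _ _ _ _ _ k)//; last by rewrite -ltnS.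
by rewrite coef_poly ifT// ltnS leq_subr.
Qed.

Lemma lmulDl : left_distributive lmul ladd.
Proof.
move=> f g h; apply/laurentP.
have [N hN] := lcoef_bounded f; have [M hM] := lcoef_bounded g.
have [P hP] := lcoef_bounded h.
have fQ : bounded_above_by f (Num.max N M).
  by move=> n; rewrite gt_max => /andP[? ?]; exact: hN.
have gQ : bounded_above_by g (Num.max N M).
  by move=> n; rewrite gt_max => /andP[? ?]; exact: hM.
have fgQ : bounded_above_by (ladd f g) (Num.max N M).
  by move=> n Qn /=; rewrite fQ ?gQ ?addr0.
apply: (@eq_bounded _ _ (Num.max N M + P)).
- exact: conv_gt.
- by move=> n Qn /=; rewrite (conv_gt fQ hP)// (conv_gt gQ hP)// addr0.
move=> k /=; rewrite !convE// -big_split/=; apply: eq_bigr => i _.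
by rewrite mulrDl.
Qed.

Lemma poly_laurent1_bounded : bounded_above_by (poly_laurent 1) 0.
Proof. by move=> -[[|n]|n]//= _; rewrite coef1. Qed.

Lemma lmul1 : left_id (poly_laurent 1) lmul.
Proof.
move=> f; apply/laurentP; have [N hN] := lcoef_bounded f.
have h1 := poly_laurent1_bounded.
apply: (@eq_bounded _ _ (0 + N)).
- exact: conv_gt.
- by rewrite add0r.
move=> k /=; rewrite convE//= big_ord_recl/= big1 => [|i _].
  by rewrite coef1 mul1r addr0 subn0 add0r.
by rewrite mul0r.
Qed.

Lemma poly_laurent1_neq0 : poly_laurent 1 != poly_laurent 0.
Proof.
by apply/eqP => /(congr1 (@lcoef K))/(congr1 (@^~ 0))/= /eqP; rewrite coef1 coef0 oner_eq0.
Qed.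

HB.instance Definition _ := GRing.Zmodule_isComNzRing.Build (laurent K)
  lmulA lmulC lmul1 lmulDl poly_laurent1_neq0.

Definition linv f : laurent K := xget 0 [set g | g * f = 1].

Lemma lead_exists f : f != 0 -> exists2 N : int, bounded_above_by f N & f N != 0.
Proof.
move=> f0; have [N hN] := lcoef_bounded f.
have [n fn] : exists n, f n != 0.
  apply: contrapT => /forallNP fn; case/eqP: f0; apply/laurentP => n.
  by have /negP := fn n; rewrite negbK => /eqP ->; case: n => [n|n] //=; rewrite coef0.
have nN : n <= N by rewrite leNgt; apply/negP => /hN E; rewrite E eqxx in fn.
have ex : exists k : nat, f (N - k%:Z) != 0.
  exists `|N - n|%N; suff -> : N - `|N - n|%N%:Z = n by [].
  by lia.
exists (N - (ex_minn ex)%:Z); last by case: ex_minnP.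
case: ex_minnP => k fk kmin m km.
have [mN|/hN//] := leP m N.
apply/eqP; apply: contraTT isT => fm.
have := kmin `|N - m|%N; have -> : N - `|N - m|%N%:Z = m by lia.
by move=> /(_ fm); lia.
Qed.

(* first coefficients of the reciprocal of a power series F with F 0 != 0 *)
Fixpoint recip_seq (F : nat -> K) (k : nat) : seq K :=
  if k is k'.+1 then
    let s := recip_seq F k' in
    rcons s (((k' == 0)%N%:R - \sum_(i < k') F i.+1 * s`_(k' - i.+1)) / F 0%N)
  else [::].

Lemma size_recip F k : size (recip_seq F k) = k.
Proof. by elim: k => //= k IH; rewrite size_rcons IH. Qed.

Lemma nth_recip F i k : (i < k)%N ->
  (recip_seq F k)`_i = (recip_seq F i.+1)`_i.
Proof.
elim: k => // k IH; rewrite ltnS leq_eqVlt => /predU1P[->//|ik].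
by rewrite [LHS]/= nth_rcons size_recip ik IH.
Qed.

Lemma recipE F k : F 0%N != 0 ->
  \sum_(i < k.+1) F i * (recip_seq F (k - i).+1)`_(k - i) = (k == 0)%N%:R.
Proof.
move=> F0; rewrite big_ord_recl subn0.
have -> : (recip_seq F k.+1)`_k =
    ((k == 0)%N%:R - \sum_(i < k) F i.+1 * (recip_seq F k)`_(k - i.+1)) / F 0%N.
  by rewrite /= nth_rcons size_recip ltnn eqxx.
rewrite mulrCA divff// mulr1.
under [X in _ + X]eq_bigr => i _.
  rewrite /= /bump/= add1n -(@nth_recip _ _ k); last by move: (ltn_ord i); lia.
  over.
by rewrite subrK.
Qed.

Lemma lmul_inv_exists f : f != 0 -> exists g, g * f = 1.
Proof.
move=> /lead_exists[N fN fN0].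
pose F (i : nat) := f (N - i%:Z).
pose G (n : int) : K :=
  if n <= - N then (recip_seq F `|- N - n|%N.+1)`_`|- N - n|%N else 0.
have GN : bounded_above_by G (- N) by move=> n Nn; rewrite /G leNgt Nn.
exists (Laurent (ex_intro _ _ GN)); rewrite mulrC; apply/laurentP.
have h1 := poly_laurent1_bounded.
apply: (@eq_bounded _ _ (N - N)).
- exact: conv_gt.
- by rewrite subrr.
move=> k; rewrite [LHS]/= convE// subrr sub0r.
transitivity ((k == 0)%N%:R : K); last by case: k => [|k] //=; rewrite coef1.
rewrite -(@recipE F) /F ?subr0//; apply: eq_bigr => i _; congr (_ * _).
rewrite /G ifT; last by lia.
suff -> : absz (- N - (- N - (k - i)%N%:Z))%R = (k - i)%N by []; lia.
Qed.

Lemma lmulV f : f != 0 -> linv f * f = 1.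
Proof.
move=> /lmul_inv_exists[g gf]; rewrite /linv.
by case: xgetP => [h _ //|/(_ g)].
Qed.

Lemma linv0 : linv 0 = 0.
Proof.
rewrite /linv; case: xgetP => [g _ /=|//].
by rewrite mulr0 => /eqP; rewrite eq_sym oner_eq0.
Qed.

HB.instance Definition _ := GRing.ComNzRing_isField.Build (laurent K) lmulV linv0.

Definition is_rational_function f : Prop :=
  exists p q : {poly K}, q != 0 /\ f = poly_laurent p / poly_laurent q.

Lemma lsubst_bounded f (d : nat) :
  exists N, bounded_above_by
    (fun n : int => if (d%:Z %| n)%Z then f (n %/ d%:Z)%Z else 0) N.
Proof.
have [N hN] := lcoef_bounded f; exists (`|N|%N * d)%N%:Z => n Nn.
case: ifP => // /dvdzP[m nE]; rewrite nE in Nn *.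
have d0 : d != 0%N by apply/eqP => d0; rewrite d0 in Nn; lia.
by rewrite mulzK//; apply: hN; nia.
Qed.

(* f(z^d), for d > 0 *)
Definition lsubst f (d : nat) : laurent K := Laurent (lsubst_bounded f d).

(* the polynomial part of f: the terms with nonnegative powers of z *)
Definition lpoly f : {poly K} :=
  xget 0 [set p : {poly K} | forall k : nat, p`_k = f k%:Z].

Lemma coef_lpoly f (k : nat) : (lpoly f)`_k = f k%:Z.
Proof.
rewrite /lpoly; case: xgetP => [p _ //|np].
have [N hN] := lcoef_bounded f.
case: (np (\poly_(i < `|N|%N.+1) f i%:Z)) => i; rewrite coef_poly.
by case: ltnP => // Ni; rewrite hN//; lia.
Qed.

Fixpoint complete_quotient f (k : nat) : laurent K :=
  if k is k'.+1 then
    (complete_quotient f k' - poly_laurent (lpoly (complete_quotient f k')))^-1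
  else f.

Definition partial_quotient f (k : nat) : {poly K} :=
  lpoly (complete_quotient f k).

(* [a_0, ..., a_k]; the one-term case [a] is a + 0^-1 = a since 0^-1 = 0 *)
Fixpoint cfrac (s : seq {poly K}) : laurent K :=
  if s is a :: s' then poly_laurent a + (cfrac s')^-1 else 0.

Definition convergent f (k : nat) : laurent K :=
  cfrac (mkseq (partial_quotient f) k.+1).

Definition is_reduced_convergent f (k : nat) (p q : {poly K}) : Prop :=
  [/\ q != 0, coprimep p q & poly_laurent p / poly_laurent q = convergent f k].

End LaurentField.

Section Values.
Variable R : realType.
Implicit Types (f : laurent rat) (x xi : R).

(* the terms of f(x) with negative exponents -1, -2, ... *)
Definition ltail f x : R^nat := fun n => ratr (f (- n.+1%:Z)) * x ^- n.+1.

Definition lvalue f x : R :=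
  (map_poly ratr (lpoly f)).[x] + limn (series (ltail f x)).

(* x lies in a region |y| > rho on which the series converges *)
Definition in_convergence_domain f x : Prop :=
  exists rho : R, [/\ 0 <= rho, rho < `|x| &
    forall y : R, rho < `|y| -> cvgn (series (ltail f y))].

(* Solutions are counted as rational numbers, i.e. as reduced fractions with
   positive denominator. *)
Definition irrationality_exponent xi : \bar R :=
  ereal_sup [set mu%:E | mu in [set mu : R |
    infinite_set [set r : rat | `|xi - ratr r| < (denq r)%:~R `^ (- mu)]]].

End Values.

(* Main.v *)
From HB Require Import structures.
Require Import Defs.
From mathcomp Require Import all_boot all_order all_algebra.
From mathcomp Require Import all_classical all_reals all_analysis.
From mathcomp Require Import zify ring lra.

(** Write [T_m = d^m ln|b|] and let [d_k] be the degree of [q_k].  Iterating the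
    functional equation [m] times and evaluating a convergent at [b^(d^m)] gives
    fractions [P/Q] approximating [xi = f(b)] with
      [ln|Q| ~ (d_k + beta) T_m]  and  [ln|Q xi - P| ~ (alpha - d_{k+1}) T_m]
    as [m] grows, where [alpha = deg A / (d-1)] and [beta = deg B / (d-1)].
    For each large [k] this yields an exponent close to [1 + d_{k+1} / d_k].
    Conversely, given a reduced fraction [u/v], choose [m] and [k] (the latter in
    a finite window above a large [K]) such that [|Q xi - P|] is below [1/(2v)]
    for [k] but not for [k - 1].  As [alpha] and [beta] are negligible against
    [d_K], this forces [|Q| <= (2v)^(1+c)] for an arbitrarily small [c].  If
    [u/v <> P/Q] then [|xi - u/v| >= 1/(2v|Q|)]; if [u/v = P/Q], possibly after a
    large cancellation, then [|xi - u/v| = |Q xi - P| / |Q|] is controlled by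
    [d_{k+1} / d_k].  No fraction [P/Q] needs to be reduced, because [v] is
    compared with [|Q|] only through the choice of [k]. *)

Set Implicit Arguments.
Unset Strict Implicit.
Unset Printing Implicit Defensive.

Import Order.TTheory GRing.Theory Num.Theory.
Import numFieldNormedType.Exports.

Local Open Scope classical_set_scope.
Local Open Scope ring_scope.

(** * Degrees and continued fractions of Laurent series *)

Section LaurentDegree.
Variable K : fieldType.
Implicit Types (f g h : laurent K) (p q : {poly K}) (N M : int).

Lemma laddE f g n : (f + g) n = f n + g n. Proof. by []. Qed.
Lemma loppE f n : (- f) n = - f n. Proof. by []. Qed.
Lemma lmulE f g n : (f * g) n = Defs.conv f g n. Proof. by []. Qed.

Lemma poly_laurent_is_additive : zmod_morphism (@poly_laurent K).
Proof.
by move=> p q; apply/laurentP => -[n|n]; rewrite laddE loppE /= ?coefB ?subrr.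
Qed.
HB.instance Definition _ :=
  GRing.isZmodMorphism.Build _ _ (@poly_laurent K) poly_laurent_is_additive.

Lemma conv1 (c : int -> K) g (j n : int) :
  (forall i, i != j -> c i = 0) -> Defs.conv c g n = c j * g (n - j).
Proof.
move=> cj; rewrite /Defs.conv (fsbigE [:: j])//=.
  by rewrite big_cons big_nil in_setT addr0.
by move=> i _; rewrite inE => /cj ->; rewrite mul0r.
Qed.

Lemma lmulXE f n : (poly_laurent 'X * f) n = f (n - 1).
Proof.
rewrite lmulE (@conv1 _ _ 1)/= ?coefX ?mul1r//.
by move=> [i|i]//= ne; rewrite coefX; case: (i =P 1%N) ne => // ->.
Qed.

Lemma lmulCE c f n : (poly_laurent c%:P * f) n = c * f n.
Proof.
rewrite lmulE (@conv1 _ _ 0)/= ?coefC ?subr0//.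
by move=> [i|i]//= ne; rewrite coefC; case: (i =P 0%N) ne => // ->.
Qed.

(** Horner induction on [p] reduces the claim to factors that are constant or ['X], for which the
    Cauchy product collapses to one term. *)
Lemma poly_laurent_is_monoid_morphism : monoid_morphism (@poly_laurent K).
Proof.
split=> // p q; elim/poly_ind: p => [|p c IH].
  by rewrite mul0r raddf0 mul0r.
rewrite mulrDl raddfD/= [X in _ = X * _]raddfD/= mulrDl; congr (_ + _); last first.
  by apply/laurentP => -[n|n]; rewrite lmulCE/= ?coefCM ?mulr0.
have mX (r : {poly K}) : poly_laurent (r * 'X) = poly_laurent 'X * poly_laurent r.
  apply/laurentP => n; rewrite lmulXE.
  case: n => [[|n]|n] //=; first by rewrite coefMX.
  by rewrite coefMX /= subn1.
by rewrite mX -(mulrA (poly_laurent 'X)) -IH -mX mulrAC.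
Qed.
HB.instance Definition _ :=
  GRing.isMonoidMorphism.Build _ _ (@poly_laurent K) poly_laurent_is_monoid_morphism.

Lemma poly_laurent_eq0 p : (poly_laurent p == 0) = (p == 0).
Proof.
apply/eqP/eqP => [p0|->]; last by rewrite raddf0.
apply/polyP => i; rewrite coef0.
by have := congr1 (fun h : laurent K => h i%:Z) p0; rewrite /= coef0.
Qed.

Definition has_degree f N := bounded_above_by f N /\ f N != 0.

Lemma has_degree_neq0 f N : has_degree f N -> f != 0.
Proof. by case=> _; apply: contraNneq => ->; case: N => n /=; rewrite ?coef0. Qed.

Lemma has_degree_uniq f N M : has_degree f N -> has_degree f M -> N = M.
Proof.
move=> [fN fN0] [fM fM0]; apply/eqP; rewrite eq_le; apply/andP; split.
- by rewrite leNgt; apply: contra fN0 => /fM ->.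
- by rewrite leNgt; apply: contra fM0 => /fN ->.
Qed.

Lemma has_degreeM f g N M :
  has_degree f N -> has_degree g M -> has_degree (f * g) (N + M).
Proof.
move=> [fN fN0] [gM gM0]; split; first exact: conv_gt.
have := convE 0 fN gM; rewrite subr0 lmulE => ->.
by rewrite big_ord1 !subr0 mulf_neq0.
Qed.

Lemma has_degree_poly p : p != 0 -> has_degree (poly_laurent p) (size p).-1%:Z.
Proof.
move=> p0; split; last by rewrite /= -lead_coefE lead_coef_eq0.
case=> // n; rewrite ltz_nat /= => pn; rewrite nth_default//.
by move: pn; case: (size p).
Qed.

Lemma has_degreeV f N : has_degree f N -> has_degree f^-1 (- N).
Proof.
move=> fN; have f0 := has_degree_neq0 fN.
have [M fM fM0] : exists2 M : int, bounded_above_by (f^-1)%R M & f^-1 M != 0.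
  by apply: lead_exists; rewrite invr_eq0.
have := has_degreeM fN (conj fM fM0); rewrite divff// => d1.
have d0 := @has_degree_poly 1 (oner_neq0 _).
rewrite size_polyC oner_neq0/= in d0.
have /eqP := has_degree_uniq d1 d0; rewrite addrC addr_eq0 => /eqP <-.
by split.
Qed.

Lemma has_degreeN f N : has_degree f N -> has_degree (- f) N.
Proof.
move=> [fN fN0]; split; last by rewrite loppE oppr_eq0.
by move=> n /fN; rewrite loppE => ->; rewrite oppr0.
Qed.

Lemma bounded_sub_lpoly f : bounded_above_by (f - poly_laurent (lpoly f)) (-1).
Proof.
by move=> [n|n] // _; rewrite laddE loppE /= coef_lpoly subrr.
Qed.

Lemma size_lpoly f (n : nat) : has_degree f n -> size (lpoly f) = n.+1.
Proof.
move=> [fn fn0]; apply/eqP; rewrite eqn_leq; apply/andP; split.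
  by apply/leq_sizeP => j nj; rewrite coef_lpoly fn.
by rewrite ltnNge; apply: contra fn0 => /leq_sizeP /(_ n (leqnn _)); rewrite coef_lpoly => ->.
Qed.

Lemma poly_laurent_rational p : is_rational_function (poly_laurent p).
Proof. by exists p, 1; rewrite oner_neq0 rmorph1 divr1. Qed.

Lemma rational_add f g : is_rational_function f -> is_rational_function g ->
  is_rational_function (f + g).
Proof.
move=> [p [q [q0 ->]]] [r [s [s0 ->]]]; exists (p * s + r * q), (q * s).
rewrite mulf_neq0//; split=> //; rewrite rmorphD !rmorphM/=.
by rewrite addf_div// poly_laurent_eq0.
Qed.

Lemma rational_inv f : is_rational_function f -> is_rational_function f^-1.
Proof.
move=> [p [q [q0 ->]]]; have [->|p0] := eqVneq p 0.
  by rewrite raddf0 mul0r invr0 -(raddf0 (@poly_laurent K)); exact: poly_laurent_rational.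
by exists q, p; rewrite invf_div.
Qed.

End LaurentDegree.

(** * Continuants, complete quotients and the errors of convergents *)

Section ContinuedFraction.
Variable K : fieldType.
Implicit Types (f : laurent K) (p q : {poly K}) (s : seq {poly K}).

(* Recursion on the head keeps [cfrac s = P / Q] valid for [s = [::]] as well:
   [P / Q = 1 / 0 = 0] is the value that [cfrac] gives there. *)
Fixpoint continuants s : {poly K} * {poly K} :=
  if s is a :: s' then
    let: (p, q) := continuants s' in (a * p + q, p)
  else (1, 0).

Lemma coprime_continuants s : coprimep (continuants s).1 (continuants s).2.
Proof.
elim: s => [|a s] /=; first by rewrite coprimep0 eqpxx.
case: (continuants s) => p q /= pq.
by rewrite coprimep_sym coprimep_addl_mul.
Qed.

(** In [a * p + q] the term [a * p] dominates, so each step adds the degree of [a]; this degree is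
    positive, which keeps the inequality strict. *)
Lemma size_continuants s : all (fun a : {poly K} => 1 < size a)%N s ->
  (size (continuants s).2 < size (continuants s).1)%N /\
  (size (continuants s).1).-1 = (\sum_(a <- s) (size a).-1)%N.
Proof.
elim: s => [_|a s IH] /=; first by rewrite big_nil size_poly0 size_poly1.
move=> /andP[a1 /IH]; case: (continuants s) => p q /= [qp pE]; rewrite big_cons -pE.
have p0 : p != 0 by rewrite -size_poly_gt0; case: (size p) qp.
have a0 : a != 0 by rewrite -size_poly_gt0; case: (size a) a1.
have p1 : (0 < size p)%N by rewrite size_poly_gt0.
have sap : size (a * p) = ((size a).-1 + (size p).-1).+1%N.
  by rewrite size_mul// {1}(polySpred a0) {1}(polySpred p0) addSn addnS.
have qap : (size q < size (a * p)%R)%N.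
  rewrite sap; apply: leq_trans qp _; rewrite {1}(polySpred p0) ltnS.
  exact: leq_addl.
rewrite size_polyDl// sap; split=> //.
rewrite {1}(polySpred p0) ltnS -[leqLHS]add1n leq_add2r.
by move: a1; case: (size a) => [|[]].
Qed.

(** [behead] because [a_0] may be constant. For the tail, positive degrees make [p] nonzero, as
    [a + q / p = (a * p + q) / p] requires. *)
Lemma cfracE s : all (fun a : {poly K} => 1 < size a)%N (behead s) ->
  cfrac s = poly_laurent (continuants s).1 / poly_laurent (continuants s).2.
Proof.
elim: s => [_|a s IH] /=; first by rewrite raddf0 invr0 mulr0.
move=> sall; rewrite IH; last by case: s sall {IH} => //= b s /andP[].
have [+ _] := size_continuants sall.
case: (continuants s) => p q /= qp.
have p0 : p != 0 by rewrite -size_poly_gt0; case: (size p) qp.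
rewrite invf_div raddfD/= rmorphM/= mulrDl mulfK// poly_laurent_eq0//.
Qed.

(** The definition unfolds at the last step; this form unfolds at the head, as [cfrac] and
    [continuants] do. *)
Lemma complete_quotientS f k :
  complete_quotient f k.+1 = complete_quotient (complete_quotient f 1) k.
Proof. by elim: k => // k IH; rewrite [LHS]/= -/(complete_quotient f k.+1) IH. Qed.

Lemma partial_quotients_cons f k : mkseq (partial_quotient f) k.+1 =
  lpoly f :: mkseq (partial_quotient (complete_quotient f 1)) k.
Proof.
rewrite /mkseq/= -[1%N]addn0 iotaDl -map_comp; congr (_ :: _).
by apply: eq_map => i /=; rewrite /partial_quotient add1n complete_quotientS.
Qed.

Section Irrational.
Variable f : laurent K.
Hypothesis f_irr : ~ is_rational_function f.

Lemma complete_quotient_irr k : ~ is_rational_function (complete_quotient f k).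
Proof.
elim: k => //= k IH /rational_inv; rewrite invrK => fr; apply: IH.
rewrite -[complete_quotient f k](subrK (poly_laurent (lpoly (complete_quotient f k)))).
by apply: rational_add => //; exact: poly_laurent_rational.
Qed.

(** The fractional part of a complete quotient is nonzero by irrationality and has degree at most
    [-1]; its reciprocal is the next one. *)
Lemma degree_complete_quotient k :
  exists n : nat, (0 < n)%N /\ has_degree (complete_quotient f k.+1) n.
Proof.
set g := complete_quotient f k.
have g0 : g - poly_laurent (lpoly g) != 0.
  rewrite subr_eq0; apply/eqP => gE; apply: (@complete_quotient_irr k).
  by rewrite -/g gE; exact: poly_laurent_rational.
have [N gN gN0] := lead_exists g0.
have N0 : N <= -1 by rewrite leNgt; apply: contra gN0 => /bounded_sub_lpoly ->.
have := has_degreeV (conj gN gN0); rewrite -/(complete_quotient f k.+1).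
have -> : - N = `|N|%N%:Z by lia.
by exists `|N|%N; split=> //; lia.
Qed.

Lemma size_partial_quotient k : (1 < size (partial_quotient f k.+1))%N.
Proof.
by have [n [n0 /size_lpoly]] := degree_complete_quotient k; rewrite /partial_quotient => ->.
Qed.

Lemma degree_complete_quotientE k :
  has_degree (complete_quotient f k.+1) (size (partial_quotient f k.+1)).-1.
Proof.
have [n [n0 fn]] := degree_complete_quotient k.
by rewrite /partial_quotient (size_lpoly fn).
Qed.

End Irrational.

(** This is [deg q_k]; the sum starts at [a_1] because [a_0] enters only the numerator. *)
Definition cf_degree f k : nat := \sum_(i < k) (size (partial_quotient f i.+1)).-1.

(* With [f_i] the complete quotients, [Q f - P = +- \prod_(1 <= i <= k) f_i^-1]:
   each step replaces [f] by [f_1] and contributes a factor [- f_1^-1]. *)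
Lemma degree_continuant_error f k : ~ is_rational_function f ->
  has_degree (poly_laurent (continuants (mkseq (partial_quotient f) k)).2 * f -
    poly_laurent (continuants (mkseq (partial_quotient f) k)).1)
    (- (cf_degree f k)%:Z).
Proof.
elim: k f => [|k IH] f f_irr.
  rewrite /= raddf0 mul0r sub0r rmorph1 /cf_degree big_ord0 oppr0.
  apply/has_degreeN; have := @has_degree_poly K 1 (oner_neq0 _).
  by rewrite size_polyC oner_neq0 rmorph1.
rewrite partial_quotients_cons/=.
have g_irr := @complete_quotient_irr _ f_irr 1.
have := IH _ g_irr.
have f1 := @degree_complete_quotientE _ f_irr 0.
have := has_degreeV f1; set g := complete_quotient f 1 in g_irr f1 *.
case: (continuants _) => p q /= gV gd.
have gE : g = (f - poly_laurent (lpoly f))^-1 by [].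
have g0 : g != 0 := has_degree_neq0 f1.
have fE : f = poly_laurent (lpoly f) + g^-1 by rewrite gE invrK addrC subrK.
have -> : poly_laurent p * f - poly_laurent (lpoly f * p + q) =
    - (g^-1 * (poly_laurent q * g - poly_laurent p)).
  by rewrite {1}fE rmorphD rmorphM/=; field.
have -> : - (cf_degree f k.+1)%:Z =
    - (size (partial_quotient f 1)).-1%:Z - (cf_degree g k)%:Z.
  rewrite /cf_degree big_ord_recl/= PoszD opprD; congr (_ - _%:Z).
  by apply: eq_bigr => i _; rewrite /partial_quotient -complete_quotientS.
by apply/has_degreeN/has_degreeM.
Qed.

Lemma cf_degree_lt f k : ~ is_rational_function f ->
  (cf_degree f k < cf_degree f k.+1)%N.
Proof.
move=> f_irr; rewrite /cf_degree big_ord_recr/= -addn1 leq_add2l.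
by rewrite -subn1 subn_gt0 (size_partial_quotient f_irr k).
Qed.

(** Two reduced forms of a fraction differ by a constant factor, which has degree [0], so the facts
    on continuants transfer. The convergent involves [a_0, ..., a_k], that is [k.+1] partial
    quotients; hence the shift in the degree of the error. *)
Lemma reduced_convergentP f k p q : ~ is_rational_function f ->
  is_reduced_convergent f k p q ->
  (size q).-1 = cf_degree f k /\
  has_degree (poly_laurent q * f - poly_laurent p) (- (cf_degree f k.+1)%:Z).
Proof.
move=> f_irr [q0 pq]; rewrite /convergent => E.
set s := mkseq _ _ in E.
have sall : all (fun a : {poly K} => 1 < size a)%N (behead s).
  rewrite /s partial_quotients_cons/=.
  apply/allP => a /mapP[i _ ->]; rewrite /partial_quotient -complete_quotientS.
  exact: size_partial_quotient.
move: E; rewrite cfracE//.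
have := @degree_continuant_error f k.+1 f_irr; rewrite -/s.
have := coprime_continuants s.
have : (size (continuants s).2).-1 = cf_degree f k /\ (continuants s).2 != 0.
  rewrite /s partial_quotients_cons/=.
  have [] := @size_continuants (mkseq (partial_quotient (complete_quotient f 1)) k).
    by rewrite /s partial_quotients_cons in sall.
  case: (continuants _) => P Q /= QP ->; split; last first.
    by rewrite -size_poly_gt0; case: (size P) QP.
  rewrite big_map /cf_degree -(big_mkord xpredT (fun i => (size (partial_quotient f i.+1)).-1)).
  rewrite /index_iota subn0; apply: eq_bigr => i _.
  by rewrite /partial_quotient -complete_quotientS.
case: (continuants s) => P Q /= [QE Q0] PQ degE E.
have qQ : p * Q = P * q.
  apply/eqP; rewrite -subr_eq0 -poly_laurent_eq0 raddfB/= !rmorphM/= subr_eq0.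
  by move/eqP: E; rewrite eqr_div ?poly_laurent_eq0.
(* By Gauss's lemma, [p * Q = P * q] and coprimality make [q] and [Q] divide each other. *)
have /eqpP[[u v] /andP[/= u0 v0] uv] : q %= Q.
  apply/andP; split.
  - by rewrite -(Gauss_dvdpr _ (_ : coprimep q p)) 1?coprimep_sym// qQ dvdp_mull.
  - by rewrite -(Gauss_dvdpr _ (_ : coprimep Q P)) 1?coprimep_sym// -qQ dvdp_mull.
have qE : q = (u^-1 * v) *: Q by rewrite -scalerA -uv scalerA mulVf// scale1r.
set c := u^-1 * v in qE.
have c0 : c != 0 by rewrite mulf_neq0 ?invr_eq0.
have pE : p = c *: P.
  by apply: (mulIf Q0); rewrite qQ qE -scalerAr scalerAl.
split; first by rewrite qE size_scale.
have dc : has_degree (poly_laurent c%:P) 0.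
  have := @has_degree_poly K c%:P; rewrite polyC_eq0 => /(_ c0).
  by rewrite size_polyC c0.
have := has_degreeM dc degE; rewrite add0r mulrBr.
by rewrite qE pE -!mul_polyC !rmorphM/= mulrA.
Qed.

End ContinuedFraction.

(** * Values of Laurent series *)

Section LaurentValue.
Variable R : realType.
Implicit Types (f g : laurent rat) (x y v : R) (N M : int).

(* Partial sums by decreasing exponents [N, N - 1, ...]; for an [N] that bounds
   [g] from above they converge to [g(y)]. *)
Definition lpartial g y N : R^nat :=
  fun n => \sum_(k < n) ratr (g (N - k%:Z)) * y ^ (N - k%:Z).

Definition has_value g y v :=
  forall N, bounded_above_by g N -> lpartial g y N @ \oo --> v.

Lemma normrXz x (n : int) : `|x ^ n| = `|x| ^ n.
Proof. by case: n => n; rewrite /= ?NegzE -?invr_expz ?normfV -exprnP normrX. Qed.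

Lemma lpartialS g y N n :
  lpartial g y (N + 1) n.+1 = ratr (g (N + 1)) * y ^ (N + 1) + lpartial g y N n.
Proof.
rewrite /lpartial big_ord_recl subr0; congr (_ + _).
by apply: eq_bigr => i _; rewrite /= /bump/= PoszD opprD addrA addrK.
Qed.

Lemma cvg_lpartialS g y N v : lpartial g y N @ \oo --> v ->
  lpartial g y (N + 1) @ \oo --> ratr (g (N + 1)) * y ^ (N + 1) + v.
Proof.
move=> gv; rewrite -cvg_shiftS; under eq_fun do rewrite lpartialS.
by apply: cvgD => //; exact: cvg_cst.
Qed.

Lemma cvg_lpartial_lower g y N v : lpartial g y N @ \oo --> v ->
  lpartial g y (N - 1) @ \oo --> v - ratr (g N) * y ^ N.
Proof.
have NE : N = N - 1 + 1 by rewrite subrK.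
rewrite -cvg_shiftS {1}NE; under eq_fun do rewrite lpartialS.
rewrite -NE => gv; rewrite addrC; set c := ratr (g N) * y ^ N in gv *.
have : (fun n => - c + (c + lpartial g y (N - 1) n)) @ \oo --> - c + v.
  by apply: cvgD; [exact: cvg_cst|exact: gv].
by under eq_fun do rewrite addKr.
Qed.

Lemma cvg_lpartial_raise g y N v (j : nat) : lpartial g y N @ \oo --> v ->
  lpartial g y (N + j%:Z) @ \oo -->
  \sum_(i < j) ratr (g (N + i.+1%:Z)) * y ^ (N + i.+1%:Z) + v.
Proof.
move=> gv; elim: j => [|j IH]; first by rewrite addr0 big_ord0 add0r.
have := cvg_lpartialS IH; rewrite big_ord_recr/= addrA [X in X + v]addrC.
by have -> : N + j%:Z + 1 = N + j.+1%:Z by lia.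
Qed.

Lemma cvg_lpartial_bounded g y N v (j : nat) : bounded_above_by g N ->
  lpartial g y (N + j%:Z) @ \oo --> v <-> lpartial g y N @ \oo --> v.
Proof.
move=> gN; have E0 i : ratr (g (N + i.+1%:Z)) = 0 :> R by rewrite gN ?rmorph0//; lia.
split; last first.
  by move=> /(@cvg_lpartial_raise _ _ _ _ j); rewrite big1 ?add0r// => i _; rewrite E0 mul0r.
elim: j => [|j IH]; first by rewrite addr0.
move=> gv; apply: IH; move: gv; rewrite -cvg_shiftS.
have -> : N + j.+1%:Z = N + j%:Z + 1 by lia.
under eq_fun do rewrite lpartialS.
have -> : N + j%:Z + 1 = N + j.+1%:Z by lia.
by under eq_fun do rewrite E0 mul0r add0r.
Qed.

(** Starting from a higher exponent only prepends zero terms, so one bound decides for all. *)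
Lemma has_valueP g y N v : bounded_above_by g N ->
  lpartial g y N @ \oo --> v -> has_value g y v.
Proof.
move=> gN gv M gM; have [NM|MN] := leP N M.
  have E : M = N + `|M - N|%N%:Z by lia.
  by rewrite E; apply/cvg_lpartial_bounded.
have E : N = M + `|N - M|%N%:Z by lia.
by move: gv; rewrite E => /cvg_lpartial_bounded; exact.
Qed.

Lemma has_value_uniq g y v w : has_value g y v -> has_value g y w -> v = w.
Proof.
have [N gN] := lcoef_bounded g => /(_ N gN) gv /(_ N gN) gw.
by apply: cvg_unique gv gw; exact: norm_hausdorff.
Qed.

Lemma lpartial_ltail f x : lpartial f x (-1) = series (ltail f x).
Proof.
apply/funext => n; rewrite /lpartial /series/= big_mkord; apply: eq_bigr => k _.
by rewrite /ltail; have -> : -1 - k%:Z = - k.+1%:Z by lia.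
Qed.

Lemma lvalueP f x : cvgn (series (ltail f x)) -> has_value f x (lvalue f x).
Proof.
move=> fx; have [N fN] := lcoef_bounded f.
have fN' : bounded_above_by f (-1 + (`|N|%N + size (lpoly f)).+1%:Z).
  by move=> n Nn; apply: fN; lia.
apply: (has_valueP fN'); rewrite -lpartial_ltail in fx.
have := @cvg_lpartial_raise _ _ _ _ (`|N|%N + size (lpoly f)).+1 fx.
rewrite /lvalue -lpartial_ltail (@horner_coef_wide _ (`|N|%N + size (lpoly f)).+1).
  congr (_ --> _ + _); apply: eq_bigr => i _.
  have -> : -1 + i.+1%:Z = i%:Z by lia.
  by rewrite coef_map/= coef_lpoly.
by rewrite size_map_poly (leq_trans (leq_addl _ _) (leqnSn _)).
Qed.

Lemma has_valueD f g x v w : has_value f x v -> has_value g x w ->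
  has_value (f + g) x (v + w).
Proof.
have [N fN] := lcoef_bounded f; have [M gM] := lcoef_bounded g.
have fL : bounded_above_by f (Num.max N M).
  by move=> n; rewrite gt_max => /andP[? ?]; exact: fN.
have gL : bounded_above_by g (Num.max N M).
  by move=> n; rewrite gt_max => /andP[? ?]; exact: gM.
move=> /(_ _ fL) fv /(_ _ gL) gw; apply: (@has_valueP _ _ (Num.max N M)).
  by move=> n Nn; rewrite laddE fL ?gL ?addr0.
suff -> : lpartial (f + g) x (Num.max N M) =
    lpartial f x (Num.max N M) \+ lpartial g x (Num.max N M) by exact: cvgD.
apply/funext => n /=; rewrite /lpartial -big_split/=; apply: eq_bigr => k _.
by rewrite rmorphD/= mulrDl.
Qed.

Lemma has_valueCM c f x v : has_value f x v ->
  has_value (poly_laurent c%:P * f) x (ratr c * v).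
Proof.
have [N fN] := lcoef_bounded f => /(_ _ fN) fv.
apply: (@has_valueP _ _ N); first by move=> n Nn; rewrite lmulCE fN ?mulr0.
suff -> : lpartial (poly_laurent c%:P * f) x N = (fun n => ratr c * lpartial f x N n).
  exact: cvgMr.
apply/funext => n; rewrite /lpartial mulr_sumr; apply: eq_bigr => k _.
by rewrite lmulCE rmorphM/= mulrA.
Qed.

Lemma has_valueXM f x v : x != 0 -> has_value f x v ->
  has_value (poly_laurent 'X * f) x (x * v).
Proof.
move=> x0; have [N fN] := lcoef_bounded f => /(_ _ fN) fv.
apply: (@has_valueP _ _ (N + 1)).
  by move=> n Nn; rewrite lmulXE fN//; lia.
suff -> : lpartial (poly_laurent 'X * f) x (N + 1) = (fun n => x * lpartial f x N n).
  exact: cvgMr.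
apply/funext => n; rewrite /lpartial mulr_sumr; apply: eq_bigr => k _.
rewrite lmulXE; have -> : N + 1 - k%:Z = (N - k%:Z) + 1 by lia.
by rewrite addrK expfzDr// expr1z; ring.
Qed.

Lemma has_value0 x : has_value 0 x 0.
Proof.
have b0 : bounded_above_by (0 : laurent rat) 0 by move=> [n|n] _ //=; rewrite coef0.
apply: (has_valueP b0).
suff -> : lpartial 0 x 0 = (fun=> 0) by exact: cvg_cst.
apply/funext => n; rewrite /lpartial big1// => k _.
suff -> : (0 : laurent rat) (0 - k%:Z) = 0 by rewrite rmorph0 mul0r.
by case: (0 - k%:Z) => i //=; rewrite coef0.
Qed.

Lemma has_valuepM p f x v : x != 0 -> has_value f x v ->
  has_value (poly_laurent p * f) x ((map_poly ratr p).[x] * v).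
Proof.
move=> x0 fv; elim/poly_ind: p => [|p c IH].
  by rewrite rmorph0 raddf0 horner0 !mul0r; exact: has_value0.
have -> : poly_laurent (p * 'X + c%:P) * f =
    poly_laurent 'X * (poly_laurent p * f) + poly_laurent c%:P * f.
  by rewrite raddfD/= rmorphM/=; ring.
have -> : (map_poly ratr (p * 'X + c%:P)).[x] * v =
    x * ((map_poly ratr p).[x] * v) + ratr c * v.
  by rewrite raddfD/= rmorphM/= map_polyX map_polyC/= hornerD hornerMX hornerC; ring.
by apply: has_valueD; [exact: has_valueXM|exact: has_valueCM].
Qed.

Lemma has_value_poly p x : x != 0 ->
  has_value (poly_laurent p) x (map_poly ratr p).[x].
Proof.
move=> x0; rewrite -[poly_laurent p]mulr1 -[(_).[x]]mulr1; apply: has_valuepM => //.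
apply: (has_valueP (@poly_laurent1_bounded _)).
rewrite -cvg_shiftS.
suff E n : lpartial 1 x 0 n.+1 = 1 by under eq_fun do rewrite E; exact: cvg_cst.
rewrite /lpartial big_ord_recl big1 => [|i _].
  by rewrite subr0 /= coef1 rmorph1 mul1r expr0z addr0.
by rewrite sub0r /= rmorph0 mul0r.
Qed.

(** Nonzero coefficients of [lsubst f d] sit at multiples of [d]: from exponent [d * N] on, its
    first [n] terms at [x] sum to the first [ceil(n / d)] terms of [f] at [x ^+ d]. *)
Lemma has_value_lsubst f d x v : (0 < d)%N -> has_value f (x ^+ d) v ->
  has_value (lsubst f d) x v.
Proof.
move=> d0; have [N fN] := lcoef_bounded f => /(_ _ fN) fv.
apply: (@has_valueP _ _ (d%:Z * N)).
  move=> n Nn /=; case: ifP => // /dvdzP[m nE]; apply: fN; rewrite nE in Nn *.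
  by rewrite mulzK; nia.
suff E n : lpartial (lsubst f d) x (d%:Z * N) n =
    lpartial f (x ^+ d) N ((n + d.-1) %/ d)%N.
  rewrite (funext E).
  apply: (@cvg_comp _ _ _ (fun n => (n + d.-1) %/ d)%N (lpartial f (x ^+ d) N)) fv.
  apply/cvgnyPge => A; exists (A * d)%N => // n /= An.
  by rewrite leq_divRL//; lia.
elim: n => [|n IH].
  by rewrite /lpartial big_ord0 divn_small ?big_ord0//; lia.
rewrite {1}/lpartial big_ord_recr -/(lpartial _ _ _ n) IH /=.
case: ifPn => [/dvdzP[m mE]|nd].
  have nE : n = (d * `|N - m|%N)%N by nia.
  have -> : ((n + d.-1) %/ d = `|N - m|%N)%N.
    by rewrite nE mulnC divnMDl// divn_small ?addn0//; lia.
  have -> : ((n.+1 + d.-1) %/ d = `|N - m|%N.+1)%N.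
    have -> : (n.+1 + d.-1 = (`|N - m|%N.+1) * d)%N by lia.
    by rewrite mulnK.
  rewrite [RHS]/lpartial big_ord_recr/=; congr (_ + _).
  have mE' : m = N - `|N - m|%N%:Z by nia.
  rewrite -mE' mE mulzK; last by lia.
  by rewrite [m * _]mulrC -exprz_exp.
rewrite raddf0 mul0r addr0; congr (lpartial _ _ _ _).
have dn : ~~ (d %| n)%N.
  apply: contra nd => /dvdnP[j ->]; apply/dvdzP; exists (N - j%:Z); lia.
have r0 : (0 < n %% d)%N by rewrite lt0n.
have rd := ltn_pmod n d0; have nE := divn_eq n d.
have -> : ((n + d.-1) = (n %/ d + 1) * d + (n %% d).-1)%N by lia.
have -> : ((n.+1 + d.-1) = (n %/ d + 1) * d + n %% d)%N by lia.
have rd' : ((n %% d).-1 < d)%N by lia.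
by rewrite !divnMDl// (divn_small rd) (divn_small rd').
Qed.

(** Convergence at [x] bounds the terms there by a constant. For [|y| >= 2 |x|] the [k]-th term at
    [y] is then at most this constant times [(|y| / |x|)^N / 2^k], and the geometric sum is at most
    [2], uniformly in [y] and [n]. *)
Lemma lpartial_bound g x N : x != 0 -> cvgn (lpartial g x N) ->
  exists2 C : R, 0 <= C &
    forall y n, 2 * `|x| <= `|y| -> `|lpartial g y N n| <= C * `|y| ^ N.
Proof.
move=> x0 gx; set t := fun k : nat => ratr (g (N - k%:Z)) * x ^ (N - k%:Z).
have gE : lpartial g x N = series t.
  by apply/funext => n; rewrite /series/= big_mkord.
rewrite gE in gx; have [B [Breal]] := cvg_series_bounded gx.
move=> /(_ (`|B| + 1)) Bt.
have {}Bt k : `|t k| <= `|B| + 1.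
  by apply: Bt => //; rewrite (le_lt_trans (ler_norm _))// ltrDl.
have ax0 : 0 < `|x| by rewrite normr_gt0.
exists (2 * (`|B| + 1) / `|x| ^ N).
  by rewrite divr_ge0 ?exprz_ge0// mulr_ge0 ?addr_ge0.
move=> y n xy; have ay0 : 0 < `|y| by apply: lt_le_trans xy; rewrite mulr_gt0.
have y0 : y != 0 by rewrite -normr_gt0.
apply: (@le_trans _ _ (\sum_(k < n) (`|B| + 1) * (`|y| / `|x|) ^ N * 2^-1 ^+ k)).
  apply: le_trans (ler_norm_sum _ _ _) _; apply: ler_sum => k _.
  have -> : ratr (g (N - k%:Z)) * y ^ (N - k%:Z) = t k * (y / x) ^ (N - k%:Z).
    by rewrite /t expfzMl exprz_inv -invr_expz; field; rewrite expfz_neq0.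
  rewrite normrM -mulrA ler_pM// normrXz normrM normfV.
  rewrite expfzDr; last by rewrite mulf_neq0 ?invr_neq0 ?normr_eq0.
  rewrite ler_pM2l; last by rewrite exprz_gt0 ?divr_gt0.
  rewrite -invr_expz -exprnP -exprVn lerXn2r ?nnegrE ?invr_ge0 ?divr_ge0//.
  by rewrite lef_pV2 ?posrE ?divr_gt0// ler_pdivlMr.
rewrite -mulr_sumr.
have -> : 2 * (`|B| + 1) / `|x| ^ N * `|y| ^ N = (`|B| + 1) * (`|y| / `|x|) ^ N * 2.
  by rewrite expfzMl exprz_inv -invr_expz; ring.
rewrite ler_wpM2l ?mulr_ge0 ?exprz_ge0 ?divr_ge0 ?addr_ge0//.
have := @subrXX _ 1 (2^-1 : R) n; rewrite expr1n => E.
have : \sum_(k < n) (2^-1 : R) ^+ k = 2 * (1 - 2^-1 ^+ n).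
  rewrite E mulrA; have -> : (2 * (1 - 2^-1) : R) = 1 by field.
  by rewrite mul1r; apply: eq_bigr => i _; rewrite expr1n mul1r.
by move=> ->; rewrite ler_piMr// gerBl exprn_ge0// invr_ge0.
Qed.

Lemma value_leading_term g x N w : x != 0 -> bounded_above_by g N ->
  has_value g x w ->
  exists2 C : R, 0 <= C & forall y v, 2 * `|x| <= `|y| -> has_value g y v ->
    `|v - ratr (g N) * y ^ N| <= C * `|y| ^ (N - 1).
Proof.
move=> x0 gN /(_ N gN)/cvg_lpartial_lower gw.
have gx : cvgn (lpartial g x (N - 1)) by apply/cvg_ex; exists (w - ratr (g N) * x ^ N).
have [C C0 Cb] := lpartial_bound x0 gx.
exists C => // y v xy /(_ N gN)/cvg_lpartial_lower gv.
apply: (ler_cvg_to (cvg_norm gv) (cvg_cst _)).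
by near=> n; exact: Cb.
Unshelve. all: by end_near. Qed.

Lemma cvg_ln_pinfty (u : R^nat) : u @ \oo --> +oo -> (fun n => ln (u n)) @ \oo --> +oo.
Proof.
move=> uoo; apply/cvgryPge => A.
have /cvgryPge/(_ (expR A)) := uoo.
apply: filterS => n un /=.
by rewrite -(expRK A) ler_ln ?posrE ?expR_gt0// (lt_le_trans _ un)// expR_gt0.
Qed.

(** The quotient [u = v / y^N] tends to the nonzero leading coefficient, so [ln |u|] is negligible
    in [ln |v| = ln |u| + N ln |y|]. *)
Lemma value_growth g x N w (y v : R^nat) : x != 0 -> has_degree g N ->
  has_value g x w -> (fun m => `|y m|) @ \oo --> +oo ->
  (forall m, has_value g (y m) (v m)) ->
  (\forall m \near \oo, v m != 0) /\
  (fun m => ln `|v m| / ln `|y m|) @ \oo --> (N%:~R : R).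
Proof.
move=> x0 [gN gN0] gw yoo gv.
have [C C0 Cb] := value_leading_term x0 gN gw.
have lnoo := cvg_ln_pinfty yoo.
have y1 : \forall m \near \oo, 1 < `|y m| by move/cvgryPgt : yoo; apply.
have yV0 : (fun m => `|y m|^-1) @ \oo --> 0.
  by apply/gtr0_cvgV0; [near=> m; rewrite (lt_trans ltr01)//; near: m|].
pose u m := v m / y m ^ N.
have uN : u @ \oo --> (ratr (g N) : R).
  suff : (fun m => `|u m - ratr (g N)|) @ \oo --> (0 : R).
    by move=> /norm_cvg0/subr_cvg0.
  apply: (@squeeze_cvgr _ _ _ _ (fun=> 0) (fun m => C * `|y m|^-1)); last first.
  - by rewrite -[X in _ --> X](mulr0 C); exact: cvgMr.
  - exact: cvg_cst.
  near=> m; rewrite normr_ge0/=.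
  have ym1 : 1 < `|y m| by near: m.
  have ym0 : 0 < `|y m| by rewrite (lt_trans ltr01).
  have y0 : y m != 0 by rewrite -normr_gt0.
  have xy : 2 * `|x| <= `|y m| by near: m; move/cvgryPge : yoo; apply.
  have yN0 : 0 < `|y m ^ N| by rewrite normr_gt0 expfz_neq0.
  rewrite -(ler_pM2r yN0) -normrM mulrBl divfK ?expfz_neq0//.
  rewrite (le_trans (Cb _ _ xy (gv m)))// normrXz -mulrA ler_wpM2l//.
  by rewrite expfzDr ?gt_eqF// exprN1 mulrC.
have u0 : \forall m \near \oo, u m != 0.
  by apply: (cvgr_neq0 _ uN); rewrite fmorph_eq0.
split; first by apply: filterS u0 => m; apply: contraNneq; rewrite /u => ->; rewrite mul0r.
have lnu : (fun m => ln `|u m|) @ \oo --> ln `|ratr (g N) : R|.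
  apply: (@cvg_comp _ _ _ (fun m => `|u m|) (@ln R)); first exact: (cvg_norm uN).
  by apply: continuous_ln; rewrite normr_gt0 fmorph_eq0.
have lnV0 : (fun m => (ln `|y m|)^-1) @ \oo --> 0.
  apply/gtr0_cvgV0 => //; near=> m; apply: ln_gt0; near: m; exact: y1.
have : (fun m => ln `|u m| * (ln `|y m|)^-1 + N%:~R) @ \oo --> (N%:~R : R).
  rewrite -[X in _ --> X]add0r -(mulr0 (ln `|ratr (g N) : R|)).
  by apply: cvgD; [exact: cvgM|exact: cvg_cst].
apply: cvg_trans; apply: near_eq_cvg; near=> m.
have ym1 : 1 < `|y m| by near: m.
have ym0 : 0 < `|y m| by rewrite (lt_trans ltr01).
have um0 : `|u m| != 0.
  by rewrite normr_eq0; near: m.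
have -> : ln `|v m| = ln `|u m| + N%:~R * ln `|y m|.
  have -> : `|v m| = `|u m| * `|y m| `^ N%:~R.
    by rewrite powR_intmul// -normrXz -normrM divfK// expfz_neq0// -normr_gt0.
  by rewrite lnM ?posrE ?powR_gt0 ?ln_powR // lt_def um0 normr_ge0.
by rewrite mulrDl mulfK// gt_eqF// ln_gt0.
Unshelve. all: by end_near. Qed.

End LaurentValue.

(** * Irrationality exponents *)

Section IrrationalityExponent.
Variable R : realType.
Implicit Types (xi mu s : R) (r : rat).

Lemma finite_bounded_denominator xi (V : R) :
  finite_set [set r : rat | (denq r)%:~R <= V /\ `|xi - ratr r| <= 1].
Proof.
pose N := Num.bound V; pose M := Num.bound ((`|xi| + 1) * `|V|).
apply: (@sub_finite_set _ _ [set` [seq (i%:Z - M%:Z)%:~R / (j%:Z)%:~R : rat |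
    i <- iota 0 (2 * M).+1, j <- iota 0 N.+1]]); last exact: finite_seq.
move=> r [rV xr]; rewrite /mkset.
have V0 : 0 <= V by apply: le_trans rV; rewrite ler0z denq_ge0.
have den0 : (0 : R) < (denq r)%:~R by rewrite ltr0z denq_gt0.
have numE : (numq r)%:~R = ratr r * (denq r)%:~R :> R by rewrite /ratr divfK// gt_eqF.
have num_le : `|(numq r)%:~R : R| <= (`|xi| + 1) * `|V|.
  rewrite numE normrM ler_pM//.
    rewrite -[ratr r](subKr xi) (le_trans (ler_normB _ _))// lerD2l//.
  by rewrite (gtr0_norm den0) (le_trans rV)// ler_norm.
have numM : `|numq r| <= M%:Z.
  rewrite -(ler_int R) intr_norm; apply: le_trans num_le _.
  by rewrite -pmulrn; apply: ltW (archi_boundP _); rewrite mulr_ge0 ?addr_ge0.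
have denN : denq r <= N%:Z.
  rewrite -(ler_int R); apply: le_trans rV _.
  by rewrite -pmulrn; apply: ltW (archi_boundP _).
have dr0 := denq_gt0 r.
apply/allpairsPdep; exists (absz (numq r + M%:Z)%R), `|denq r|%N; split.
- by rewrite mem_iota; lia.
- by rewrite mem_iota; lia.
- rewrite absz_denq -[LHS]divq_num_den; congr (_%:~R / _).
  by lia.
Qed.

(** As [mu >= 0], every solution lies within [1] of [xi]; with bounded denominators only finitely
    many remain. *)
Lemma irrationality_exponent_le xi s : 0 <= s ->
  (forall mu, s < mu -> exists V : R, forall r,
     `|xi - ratr r| < (denq r)%:~R `^ (- mu) -> (denq r)%:~R <= V) ->
  (irrationality_exponent xi <= s%:E)%E.
Proof.
move=> s0 H; apply: ge_ereal_sup => _ [mu /= infmu <-].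
rewrite lee_fin leNgt; apply/negP => smu; apply: infmu.
have [V HV] := H _ smu; apply: sub_finite_set (finite_bounded_denominator xi V).
move=> r /= xr; split; first exact: HV.
apply/ltW/(lt_le_trans xr).
rewrite powRN invf_le1; last by rewrite powR_gt0 ?ltr0z ?denq_gt0.
rewrite -[leLHS](powRr0 (denq r)%:~R) ler_powR//; last exact: le_trans (ltW smu).
by rewrite ler1z -gtz0_ge1 denq_gt0.
Qed.

Lemma distance_to_finite xi (s : seq rat) : exists2 e : R, 0 < e &
  forall r, r \in s -> xi != ratr r -> e <= `|xi - ratr r|.
Proof.
elim: s => [|r s [e e0 es]]; first by exists 1.
have [xr|xr] := eqVneq xi (ratr r).
  exists e => // t; rewrite inE => /predU1P[->|]; last exact: es.
  by rewrite xr eqxx.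
exists (Num.min e `|xi - ratr r|).
  by rewrite lt_min e0 normr_gt0 subr_eq0.
move=> t; rewrite inE => /predU1P[-> _|ts xt]; first by rewrite ge_min lexx orbT.
by rewrite ge_min es.
Qed.

Lemma denq_frac_le (a b : int) : b != 0 ->
  (denq (a%:~R / b%:~R) <= `|b|)%R.
Proof.
case: divqP => [|k x k0 _]; first by rewrite eqxx.
rewrite normrM normr_denq ler_peMl ?denq_ge0//.
by rewrite -gtz0_ge1 normr_gt0.
Qed.

(** Fractions need not be reduced: reduction shrinks the denominator, which weakens the inequality
    as [mu >= 0]. Positive but arbitrarily small distances exclude a finite set of solutions. *)
Lemma irrationality_exponent_ge xi mu : 0 <= mu ->
  (forall e : R, 0 < e -> exists a b : int, [/\ b != 0,
     0 < `|xi - a%:~R / b%:~R| < e &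
     `|xi - a%:~R / b%:~R| < `|b%:~R| `^ (- mu)]) ->
  (mu%:E <= irrationality_exponent xi)%E.
Proof.
move=> mu0 H; apply: ereal_sup_ubound; exists mu => //= /finite_seqP[s sE].
have [e e0 es] := distance_to_finite xi s.
have [a [b [b0 /andP[ab0 abe] abmu]]] := H _ e0.
pose r : rat := a%:~R / b%:~R.
have rE : ratr r = a%:~R / b%:~R :> R by rewrite fmorph_div/= !ratr_int.
rewrite -rE in ab0 abe abmu.
have : [set` s] r.
  rewrite -sE /=; apply: lt_le_trans abmu _.
  have d0 : (0 : R) < (denq r)%:~R by rewrite ltr0z denq_gt0.
  rewrite !powRN lef_pV2 ?posrE ?powR_gt0 ?normr_gt0 ?intr_eq0//.
  apply: ge0_ler_powR => //; rewrite ?nnegrE ?(ltW d0)//.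
  by rewrite -intr_norm ler_int denq_frac_le.
move=> /= rs; have := es _ rs; rewrite -subr_eq0 -normr_gt0 => /(_ ab0).
by rewrite leNgt abe.
Qed.

End IrrationalityExponent.

(** * Limits superior of extended real sequences *)

Section LimnEsup.
Variable R : realType.
Implicit Types (u : (\bar R)^nat) (x : \bar R).
Local Open Scope ereal_scope.

Lemma lt_limn_esup u x n : x < limn_esup u -> exists2 k, (n <= k)%N & x < u k.
Proof.
move=> xu; have : x < ereal_sup [set u k | k in [set k | (n <= k)%N]].
  apply: lt_le_trans xu _; apply: ereal_inf_lbound => /=.
  by exists [set k | (n <= k)%N] => //=; exists n.
by move=> /ereal_sup_gt[_ /= [k nk <-] xk]; exists k.
Qed.

Lemma limn_esup_lt u x : limn_esup u < x ->
  exists n, forall k, (n <= k)%N -> u k < x.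
Proof.
move=> /ereal_inf_lt[_ /= [V [n _ nV] <-] ux]; exists n => k nk.
apply: le_lt_trans ux; apply: ereal_sup_ubound; exists k => //; exact: nV.
Qed.

End LimnEsup.

Lemma near_all_le (K : nat) (P : nat -> nat -> Prop) :
  (forall k, (k <= K)%N -> \forall m \near \oo, P k m) ->
  \forall m \near \oo, forall k, (k <= K)%N -> P k m.
Proof.
elim: K => [|K IH] H.
  by have := H 0%N isT; apply: filterS => m Pm k; rewrite leqn0 => /eqP ->.
have := IH (fun k kK => H k (leqW kK)).
apply: filterS2 (H K.+1 (leqnn _)) => m PK Pm k.
by rewrite leq_eqVlt => /predU1P[->//|]; exact: Pm.
Qed.

Lemma near_lt_of_cvg (R : realType) (u : R^nat) (l z : R) :
  u @ \oo --> l -> l < z -> \forall m \near \oo, u m < z.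
Proof. by move=> ul lz; exact: (cvgr_lt _ ul). Qed.

Lemma near_gt_of_cvg (R : realType) (u : R^nat) (l z : R) :
  u @ \oo --> l -> z < l -> \forall m \near \oo, z < u m.
Proof. by move=> ul lz; exact: (cvgr_gt _ ul). Qed.

(** * The exponent of a number with a two-parameter family of approximations *)

Section ApproximationFamily.
Variables (R : realType) (xi : R) (d : nat) (D : nat -> nat) (alpha beta : R).
Variables (T : R^nat) (P Q : nat -> nat -> int).
Hypotheses (D_lt : forall k, (D k < D k.+1)%N).
Hypotheses (alpha_ge0 : 0 <= alpha) (beta_ge0 : 0 <= beta).
Hypotheses (T_gt0 : forall m, 0 < T m) (T_oo : T @ \oo --> +oo).
Hypothesis T_geo : forall m, T m.+1 = d%:R * T m.

Let q k m : R := ln `|(Q k m)%:~R|.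
Let eps k m : R := ln `|(Q k m)%:~R * xi - (P k m)%:~R|.

Hypothesis cvg_q : forall k, (fun m => q k m / T m) @ \oo --> (D k)%:R + beta.
Hypothesis cvg_eps :
  forall k, (fun m => eps k m / T m) @ \oo --> alpha - (D k.+1)%:R.

Lemma leq_D k : (k <= D k)%N.
Proof. by elim: k => // k /leq_ltn_trans; apply. Qed.

Lemma q_gt0_near k : (0 < k)%N -> \forall m \near \oo, 0 < q k m.
Proof.
move=> k0; have D0 : (0 : R) < (D k)%:R + beta.
  by rewrite ltr_wpDr// ltr0n (leq_trans k0)// leq_D.
have := near_gt_of_cvg (@cvg_q k) D0; apply: filterS => m.
by rewrite pmulr_lgt0// invr_gt0.
Qed.

Lemma eps_lt0_near k : alpha < (D k.+1)%:R -> \forall m \near \oo, eps k m < 0.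
Proof.
rewrite -subr_lt0 => ak; have := near_lt_of_cvg (@cvg_eps k) ak; apply: filterS => m.
by rewrite pmulr_llt0// invr_gt0.
Qed.

Lemma eps_ltNy k (A : R) : alpha < (D k.+1)%:R -> \forall m \near \oo, eps k m < A.
Proof.
move=> ak; set c := (D k.+1)%:R - alpha; have c0 : 0 < c by rewrite subr_gt0.
have lim : alpha - (D k.+1)%:R < - (c / 2) by rewrite /c; lra.
have /cvgryPgt/(_ (- A * 2 / c)) TA := T_oo.
apply: filterS2 TA (near_lt_of_cvg (@cvg_eps k) lim) => m TA.
rewrite ltr_pdivrMr// => /lt_le_trans; apply.
move: TA; rewrite ltr_pdivrMr// => TA; nra.
Qed.

(* Since [ln 0 = 0], a nonzero logarithm shows that its argument is nonzero. *)
Lemma expR_ln_norm (x : R) : ln `|x| != 0 -> `|x| = expR (ln `|x|).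
Proof.
move=> lx; rewrite lnK// posrE normr_gt0; apply: contraNneq lx => ->.
by rewrite normr0 ln0.
Qed.

(** For large [k] the gap [r - s] absorbs [alpha] and [beta], so [eps < - s q] for large [m], and
    [|xi - P / Q| = exp (eps - q) < |Q|^-(1 + s)]. One such [k] suffices: letting [m] grow makes the
    distance arbitrarily small. *)
Lemma exponent_lower (r s : R) : 0 <= s -> s < r ->
  (forall n, exists2 k, (n <= k)%N & r * (D k)%:R < (D k.+1)%:R) ->
  ((1 + s)%:E <= irrationality_exponent xi)%E.
Proof.
move=> s0 sr H; pose n := (Num.bound ((s * beta + alpha) / (r - s))).+1.
have [k nk rD] := H n.
have Dk : (s * beta + alpha) / (r - s) < (D k)%:R.
  apply: lt_le_trans (archi_boundP _) _.
    by rewrite divr_ge0 ?subr_ge0 ?(ltW sr)// addr_ge0// mulr_ge0.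
  by rewrite ler_nat (leq_trans _ (leq_D k))// (leq_trans _ nk).
rewrite ltr_pdivrMr ?subr_gt0// in Dk.
have sD : s * ((D k)%:R + beta) < (D k.+1)%:R - alpha by nra.
have k0 : (0 < k)%N by apply: leq_trans nk.
have ak : alpha < (D k.+1)%:R.
  by rewrite -subr_gt0; apply: le_lt_trans sD; rewrite mulr_ge0// addr_ge0.
have sqe : \forall m \near \oo, eps k m + s * q k m < 0.
  have lim : (fun m => eps k m / T m + s * (q k m / T m)) @ \oo -->
      alpha - (D k.+1)%:R + s * ((D k)%:R + beta).
    by apply: cvgD => //; apply: cvgMr.
  have neg : alpha - (D k.+1)%:R + s * ((D k)%:R + beta) < 0 by lra.
  have := near_lt_of_cvg lim neg; apply: filterS => m.
  by rewrite mulrA -mulrDl pmulr_llt0// invr_gt0.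
apply: irrationality_exponent_ge; first by rewrite addr_ge0.
move=> e e0.
have [m [[qm em] sm lm]] : exists m, [/\ 0 < q k m /\ eps k m < 0,
    eps k m + s * q k m < 0 & eps k m < ln e].
  suff : \forall m \near \oo, [/\ 0 < q k m /\ eps k m < 0,
    eps k m + s * q k m < 0 & eps k m < ln e] by case=> N _ /(_ N (leqnn N)) ?; exists N.
  near=> m; split; last by near: m; exact: eps_ltNy.
  - by split; near: m; [exact: q_gt0_near|exact: eps_lt0_near].
  - by near: m.
have qE := expR_ln_norm (lt0r_neq0 qm).
have eE := expR_ln_norm (ltr0_neq0 em).
rewrite -/(q k m) in qE; rewrite -/(eps k m) in eE.
have Q0 : (Q k m)%:~R != 0 :> R by rewrite -normr_gt0 qE expR_gt0.
exists (P k m), (Q k m).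
have -> : xi - (P k m)%:~R / (Q k m)%:~R =
    ((Q k m)%:~R * xi - (P k m)%:~R) / (Q k m)%:~R by field.
rewrite normrM normfV eE qE -expRN -expRD; split.
- by rewrite -(intr_eq0 R).
- rewrite expR_gt0/= -(@lnK _ e)// ltr_expR; lra.
- rewrite /powR gt_eqF ?expR_gt0// expRK ltr_expR; lra.
Unshelve. all: by end_near. Qed.

Lemma exponent_upper (L : R) (n0 : nat) : 1 <= L ->
  (forall k, (n0 <= k)%N -> (D k.+1)%:R < L * (D k)%:R) ->
  (irrationality_exponent xi <= (1 + L)%:E)%E.
Proof.
move=> L1 HL; apply: irrationality_exponent_le; first lra.
move=> mu Lmu.
have [c [c0 c1 cL]] : exists c : R, [/\ 0 < c, c <= 1 & c * (L + 4) <= mu - 1 - L].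
  exists (Num.min 1 ((mu - 1 - L) / (L + 4))); split.
  - by rewrite lt_min ltr01/= divr_gt0//; lra.
  - by rewrite ge_min lexx.
  - by rewrite -ler_pdivlMr ?ge_min ?lexx ?orbT//; lra.
(* The bound reached below is [|xi - r| >= (2v)^-M]: the factor [1 + c] comes from
   [|Q| <= (2v)^(1+c)], and [1 + L + c] from the exponent relative to [|Q|]. *)
pose M : R := (1 + c) * (1 + L + c).
have Mmu : M < mu by rewrite /M; nra.
have M2 : 2 + c <= M by rewrite /M; nra.
(* From [K] on, [alpha] and [beta] are negligible against [D k]; the window
   [K, K'] covers one step [m -> m + 1], where the exponents grow by [d]. *)
pose K := maxn n0 (Num.bound ((beta + (1 + c) * alpha) / c)).+1.
have KD k : (K <= k)%N -> (D k)%:R + beta < (1 + c) * ((D k)%:R - alpha).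
  move=> Kk; have : (beta + (1 + c) * alpha) / c < (D k)%:R.
    apply: lt_le_trans (archi_boundP _) _.
      by rewrite divr_ge0 ?(ltW c0)// addr_ge0// mulr_ge0//; lra.
    rewrite ler_nat; apply: leq_trans (leq_D k); apply: leq_trans Kk.
    by rewrite leq_max leqnSn orbT.
  by rewrite ltr_pdivrMr//; nra.
have K0 k : (K <= k)%N -> (0 < k)%N.
  by apply: leq_trans; rewrite leq_max orbT.
have aD k : (K <= k)%N -> alpha < (D k)%:R.
  move=> /KD KDk; have : 0 < (1 + c) * ((D k)%:R - alpha).
    by apply: le_lt_trans KDk; rewrite addr_ge0.
  by rewrite pmulr_rgt0 ?subr_gt0//; lra.
have [K' KK' HK'] : exists2 K', (K <= K')%N &
    d%:R * ((D K.+1)%:R - alpha) < (D K'.+1)%:R - alpha.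
  exists (maxn K (Num.bound (`|d%:R * ((D K.+1)%:R - alpha) + alpha|))).
    exact: leq_maxl.
  rewrite ltrBrDr; apply: le_lt_trans (ler_norm _) _.
  apply: lt_le_trans (archi_boundP _) _ => //; rewrite ler_nat.
  by apply: leq_trans (leq_trans (leqnSn _) (leq_D _)); rewrite leq_maxr.
(* The next denominator is compared with the current error, because the search below bounds from
   below only the error just before the threshold is crossed. *)
have near_q : \forall m \near \oo, forall k, (k <= K')%N -> (K <= k)%N ->
    [/\ q k.+1 m <= (1 + c) * - eps k m, - eps k m <= (L + c) * q k m,
        0 < q k m & eps k m < 0].
  apply: near_all_le => k _; have [Kk|kK] := leqP K k; last first.
    exact: nearW.
  have lim1 : (fun m => q k.+1 m / T m + (1 + c) * (eps k m / T m)) @ \oo -->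
      (D k.+1)%:R + beta + (1 + c) * (alpha - (D k.+1)%:R).
    by apply: cvgD => //; apply: cvgMr.
  have neg1 : (D k.+1)%:R + beta + (1 + c) * (alpha - (D k.+1)%:R) < 0.
    by have := KD _ (leqW Kk); nra.
  have lim2 : (fun m => eps k m / T m + (L + c) * (q k m / T m)) @ \oo -->
      alpha - (D k.+1)%:R + (L + c) * ((D k)%:R + beta).
    by apply: cvgD => //; apply: cvgMr.
  have pos2 : 0 < alpha - (D k.+1)%:R + (L + c) * ((D k)%:R + beta).
    have LD := HL k (leq_trans (leq_maxl _ _) Kk).
    have cD : 0 < c * (D k)%:R.
      by rewrite mulr_gt0// ltr0n (leq_trans (K0 _ Kk))// leq_D.
    have Lb : 0 <= (L + c) * beta by rewrite mulr_ge0//; lra.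
    by move: LD cD Lb alpha_ge0; lra.
  near=> m => _; split.
  - have : q k.+1 m / T m + (1 + c) * (eps k m / T m) < 0.
      by near: m; exact: near_lt_of_cvg lim1 neg1.
    rewrite mulrA -mulrDl pmulr_llt0 ?invr_gt0//; lra.
  - have : 0 < eps k m / T m + (L + c) * (q k m / T m).
      by near: m; exact: near_gt_of_cvg lim2 pos2.
    rewrite mulrA -mulrDl pmulr_lgt0 ?invr_gt0//; lra.
  - by near: m; exact: q_gt0_near (K0 _ Kk).
  - by near: m; apply: eps_lt0_near; exact: aD (leqW Kk).
have near_eps : \forall m \near \oo, eps K' m < eps K m.+1.
  have lim : (fun m => eps K' m / T m - d%:R * (eps K m.+1 / T m.+1)) @ \oo -->
      alpha - (D K'.+1)%:R - d%:R * (alpha - (D K.+1)%:R).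
    apply: cvgB => //; apply: cvgMr.
    by rewrite (cvg_shiftS (fun m => eps K m / T m)).
  have neg : alpha - (D K'.+1)%:R - d%:R * (alpha - (D K.+1)%:R) < 0 by lra.
  have := near_lt_of_cvg lim neg; apply: filterS => m.
  have d0 : d%:R != 0 :> R.
    by apply: contraTneq (T_gt0 m.+1) => d0; rewrite T_geo d0 mul0r ltxx.
  have -> : d%:R * (eps K m.+1 / T m.+1) = eps K m.+1 / T m.
    by rewrite T_geo; field; rewrite d0 gt_eqF.
  by rewrite -mulrBl pmulr_llt0 ?invr_gt0// subr_lt0.
have [m0 Hm0] : exists m0, forall m, (m0 <= m)%N -> eps K' m < eps K m.+1 /\
    forall k, (k <= K')%N -> (K <= k)%N ->
    [/\ q k.+1 m <= (1 + c) * - eps k m, - eps k m <= (L + c) * q k m,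
        0 < q k m & eps k m < 0].
  suff [m0 _ H] : \forall m \near \oo, eps K' m < eps K m.+1 /\
    forall k, (k <= K')%N -> (K <= k)%N ->
    [/\ q k.+1 m <= (1 + c) * - eps k m, - eps k m <= (L + c) * q k m,
        0 < q k m & eps k m < 0] by exists m0.
  by near=> m; split; near: m.
(* When [w > W], the first entry keeps [eps K m0] above [- w], and the second gives
   [M * w < mu * ln v], absorbing the factor [2]. *)
pose W := Num.max (- eps K m0) (mu * ln 2 / (mu - M)).
exists (expR W) => r rmu.
set v : R := (denq r)%:~R in rmu *.
have v1 : 1 <= v by rewrite ler1z -gtz0_ge1 denq_gt0.
have v0 : 0 < v by lra.
(* [exp (- w) = 1 / (2v)] is the threshold for [|Q xi - P|]. *)
pose w := ln (2 * v).
have wE : w = ln 2 + ln v by rewrite /w lnM ?posrE.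
have ln2 : 0 < ln 2 :> R by rewrite ln_gt0//; lra.
have lnv : 0 <= ln v by exact: ln_ge0.
suff wW : w <= W.
  by rewrite -(@lnK _ v)// ler_expR; lra.
rewrite leNgt; apply/negP; rewrite gt_max => /andP[wm0 wmu].
suff : expR (- (M * w)) <= `|xi - ratr r|.
  move=> /le_lt_trans/(_ rmu); rewrite /powR gt_eqF// ltr_expR.
  move: wmu; rewrite ltr_pdivrMr ?subr_gt0// wE; nra.
(* [m.+1] is the first stage from [m0] on at which index [K] passes the threshold. *)
have [m [mm0 epsm epsm1]] : exists m, [/\ (m0 <= m)%N, - w <= eps K m & eps K m.+1 < - w].
  have ex : exists m, (m0 <= m)%N && (eps K m < - w).
    have [m1 _ H] : \forall m \near \oo, eps K m < - w.
      by apply: eps_ltNy; apply: aD; exact: leqnSn.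
    by exists (maxn m0 m1); rewrite leq_maxl H//= leq_maxr.
  case: (ex_minnP ex) => -[|m] /andP[mm0 em] minm.
    have m00 : m0 = 0%N by apply/eqP; rewrite -leqn0.
    by move: em; rewrite ltNge -m00 => /negP[]; lra.
  move: mm0; rewrite leq_eqVlt => /predU1P[m0E|mm0].
    by move: em; rewrite ltNge -m0E => /negP[]; lra.
  exists m; split => //; rewrite leNgt; apply/negP => emw.
  by have := minm m; rewrite -ltnS mm0 emw => /(_ isT); rewrite ltnn.
have [epsK' Hk] := Hm0 _ mm0.
(* At stage [m], index [K] has not passed the threshold while [K'] has, since
   [eps K' m < eps K m.+1]; [k.+1] is the first index to pass. *)
have [k [Kk kK' epsk epsk1]] : exists k,
    [/\ (K <= k)%N, (k.+1 <= K')%N, - w <= eps k m & eps k.+1 m < - w].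
  have ex : exists k, (K <= k)%N && (eps k m < - w).
    by exists K'; rewrite KK'/= (lt_trans epsK').
  case: (ex_minnP ex) => -[|k] /andP[Kk ek] mink.
    by have := K0 _ Kk.
  move: Kk; rewrite leq_eqVlt => /predU1P[KE|Kk].
    by move: ek; rewrite ltNge -KE => /negP[]; lra.
  exists k; split => //.
  - by apply: mink; rewrite KK'/= (lt_trans epsK').
  - rewrite leNgt; apply/negP => ekw.
    by have := mink k; rewrite -ltnS Kk ekw => /(_ isT); rewrite ltnn.
have [q1 _ _ _] := Hk _ (ltnW kK') Kk.
have [_ e1 qpos eneg] := Hk _ kK' (leqW Kk).
(* Index [k] has not passed, that is [- eps k m <= w], and this bounds the denominator of index
   [k.+1]. *)
have qw : q k.+1 m <= (1 + c) * w by apply: le_trans q1 _; nra.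
have qE := expR_ln_norm (lt0r_neq0 qpos).
have eE := expR_ln_norm (ltr0_neq0 eneg).
rewrite -/(q k.+1 m) in qE; rewrite -/(eps k.+1 m) in eE.
set q' := q k.+1 m in qE qw qpos q1 e1; set e' := eps k.+1 m in eE eneg epsk1 e1.
set Qz := Q k.+1 m in qE eE; set Pz := P k.+1 m in eE.
have Q0 : Qz%:~R != 0 :> R by rewrite -normr_gt0 qE expR_gt0.
have w0 : 0 < w by lra.
have rE : ratr r = (numq r)%:~R / v :> R by [].
have vn0 : v != 0 by rewrite gt_eqF.
(* If [r = P / Q] then [|xi - r|] is known exactly, and otherwise
   [1 <= |u Q - P v| <= v |Q xi - P| + v |Q| |xi - u / v|]. *)
have [E|NE] := eqVneq (numq r * Qz) (Pz * denq r).
  have ER : (numq r)%:~R * Qz%:~R = Pz%:~R * v :> R by rewrite -!intrM E.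
  have -> : xi - ratr r = (Qz%:~R * xi - Pz%:~R) / Qz%:~R.
    have -> : ratr r = Pz%:~R / Qz%:~R :> R.
      by rewrite rE; apply/eqP; rewrite eqr_div// ER.
    by field.
  rewrite normrM normfV eE qE -expRN -expRD ler_expR.
  (* With [- e' <= (L + c) * q'] this gives [q' - e' <= M * w]. *)
  have : (1 + L + c) * q' <= (1 + L + c) * ((1 + c) * w) by rewrite ler_pM2l//; lra.
  by rewrite /M; lra.
have N1 : 1 <= `|(numq r)%:~R * Qz%:~R - Pz%:~R * v|.
  rewrite -!intrM -intrB -intr_norm ler1z -gtz0_ge1 normr_gt0 subr_eq0//.
have small : v * `|Qz%:~R * xi - Pz%:~R| <= 2^-1.
  rewrite eE; have : expR e' <= expR (- w) by rewrite ler_expR ltW.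
  rewrite expRN (@lnK _ (2 * v)) ?posrE ?mulr_gt0// => /(ler_wpM2l (ltW v0)).
  by move=> /le_trans; apply; rewrite invfM mulrCA mulfV// mulr1.
have half : 2^-1 <= v * (expR q' * `|xi - ratr r|).
  have E : (numq r)%:~R * Qz%:~R - Pz%:~R * v =
      v * (Qz%:~R * xi - Pz%:~R) - v * (Qz%:~R * (xi - ratr r)).
    by rewrite rE; field.
  have := ler_normB (v * (Qz%:~R * xi - Pz%:~R)) (v * (Qz%:~R * (xi - ratr r))).
  rewrite -E !normrM (gtr0_norm v0) -qE; lra.
have -> : `|xi - ratr r| = v * (expR q' * `|xi - ratr r|) / (v * expR q').
  by field; rewrite vn0 gt_eqF ?expR_gt0.
apply: le_trans (_ : _ <= 2^-1 / (v * expR q')) _; last first.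
  by rewrite ler_wpM2r// invr_ge0 mulr_ge0 ?expR_ge0// ltW.
have -> : 2^-1 / (v * expR q') = expR (- w - q').
  rewrite expRD !expRN (@lnK _ (2 * v)) ?posrE ?mulr_gt0//.
  by field; rewrite vn0 gt_eqF ?expR_gt0.
(* The lower bound [1 / (2v|Q|)] is at least [exp (- (2 + c) * w)]. *)
rewrite ler_expR; have : (2 + c) * w <= M * w by rewrite ler_pM2r.
by lra.
Unshelve. all: by end_near. Qed.

(** Reals above and below the limit superior feed the two bounds. [D 0] may be [0], making the first
    ratio [0] by convention, so only indices [k >= 1] are used. *)
Lemma exponent_limn_esup : irrationality_exponent xi =
  (1 + limn_esup (fun k => ((D k.+1)%:R / (D k)%:R)%:E))%E.
Proof.
set u := fun k => _; set l := limn_esup u.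
have D0 k : (0 < k)%N -> (0 : R) < (D k)%:R.
  by move=> k0; rewrite ltr0n (leq_trans k0)// leq_D.
have l1 : (1 <= l)%E.
  rewrite leNgt; apply/negP => /limn_esup_lt[n] /(_ n.+1 (leqnSn _)).
  rewrite /u lte_fin ltr_pdivrMr ?D0// mul1r ltr_nat => /ltn_trans.
  by move=> /(_ _ (D_lt _)); rewrite ltnn.
have lower (s r : R) : 0 <= s -> s < r -> (r%:E < l)%E ->
    ((1 + s)%:E <= irrationality_exponent xi)%E.
  move=> s0 sr rl; apply: (exponent_lower s0 sr) => n.
  have [k nk xk] := lt_limn_esup n.+1 rl; exists k; first exact: ltnW.
  move: xk; rewrite /u lte_fin ltr_pdivlMr ?D0//.
  by apply: leq_trans nk.
have upper (L : R) : (l < L%:E)%E -> (irrationality_exponent xi <= (1 + L)%:E)%E.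
  move=> lL; have L1 : 1 <= L by rewrite -lee_fin (le_trans l1)// ltW.
  have [n Hn] := limn_esup_lt lL; apply: (@exponent_upper L n.+1 L1) => k nk.
  have := Hn k (ltnW nk); rewrite /u lte_fin ltr_pdivrMr ?D0//.
  exact: leq_trans nk.
case: l l1 lower upper => [l||] l1 lower upper; last by rewrite leeNy_eq in l1.
- apply/eqP; rewrite eq_le; apply/andP; split.
    apply/lee_addgt0Pr => e e0; rewrite -!EFinD -addrA; apply: upper.
    by rewrite lte_fin ltrDl.
  have l1' : 1 <= l by rewrite -lee_fin.
  apply/lee_subgt0Pr => e e0.
  apply: (@le_trans _ _ (1 + (l - Num.min e 1))%:E).
    rewrite (_ : (_ - _)%E = (1 + l - e)%:E)// lee_fin addrA lerB//.
    by rewrite ge_min lexx.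
  have m0 : 0 < Num.min e 1 by rewrite lt_min e0 ltr01.
  have m1 : Num.min e 1 <= 1 by rewrite ge_min lexx orbT.
  (* Capping [e] at [1] keeps [s = l - Num.min e 1] nonnegative, as [l >= 1]; [r] is midway between
     [s] and [l]. *)
  by apply: (lower _ (l - Num.min e 1 / 2)); rewrite ?lte_fin; lra.
- rewrite addey//; apply: eq_infty => r.
  apply: (@le_trans _ _ (1 + `|r|)%:E).
    by rewrite lee_fin (le_trans (ler_norm r))// lerDr.
  by apply: (lower _ (`|r| + 1)); rewrite ?ltry// ltrDl.
Qed.

End ApproximationFamily.

(** * Approximations of a Mahler number *)

Section GeometricSums.
Variable R : realType.

(** Once [|delta| <= h / 2], the recursion preserves the term [h / 2] in the bound and halves the
    rest at each step. *)
Lemma contraction_cvg0 (e delta : R^nat) :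
  (forall m, `|e m.+1| <= (`|e m| + `|delta m|) / 2) ->
  delta @ \oo --> 0 -> e @ \oo --> 0.
Proof.
move=> He /cvgr0Pnorm_le Hdelta; apply/cvgr0Pnorm_le => h h0.
have h2 : (0 : R) < h / 2 by rewrite divr_gt0.
have [N _ HN] := Hdelta _ h2.
have bound j : `|e (j + N)%N| <= `|e N| * 2^-1 ^+ j + h / 2.
  elim: j => [|j IH]; first by rewrite expr0 mulr1 lerDl divr_ge0 ?ltW.
  have := He (j + N)%N; have := HN (j + N)%N (leq_addl _ _); rewrite /= exprS; lra.
have : (fun j => `|e N| * 2^-1 ^+ j) @ \oo --> `|e N| * 0.
  by apply: cvgMr; apply: cvg_expr; rewrite ger0_norm ?invr_ge0//; lra.
rewrite mulr0 => /near_lt_of_cvg/(_ h2)[M _ HM].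
exists (M + N)%N => // m /= MNm.
have mE : m = (m - N + N)%N by lia.
have Mm : (M <= m - N)%N by lia.
by rewrite mE; have := bound (m - N)%N; have := HM _ Mm; rewrite /=; lra.
Qed.

(** The quotients satisfy [s_(m+1) = (s_m + x_m / T_m) / d], a contraction as [d >= 2]; for constant
    input [l] its fixed point is [l / (d - 1)]. This is the origin of the denominators of [alpha]
    and [beta]. *)
Lemma cvg_geometric_sum (d : nat) (T x : R^nat) (l : R) : (2 <= d)%N ->
  (forall m, 0 < T m) -> (forall m, T m.+1 = d%:R * T m) ->
  (fun m => x m / T m) @ \oo --> l ->
  (fun m => (\sum_(t < m) x t) / T m) @ \oo --> l / (d%:R - 1).
Proof.
move=> d2 T0 TS xl.
have d2R : 2 <= d%:R :> R by rewrite ler_nat.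
apply/subr_cvg0.
apply: (@contraction_cvg0 _ (fun m => x m / T m - l)); last exact/subr_cvg0.
move=> m /=.
have -> : (\sum_(t < m.+1) x t) / T m.+1 - l / (d%:R - 1) =
    ((\sum_(t < m) x t) / T m - l / (d%:R - 1) + (x m / T m - l)) / d%:R.
  rewrite big_ord_recr/= TS; field; rewrite !gt_eqF//; lra.
rewrite normrM normfV [`|d%:R|]ger0_norm//.
apply: ler_pM; rewrite ?invr_ge0//; first exact: ler_normD.
by rewrite lef_pV2 ?posrE//; lra.
Qed.

End GeometricSums.

Local Notation pZtoQ := (map_poly (intr : int -> rat)).

(** One scalar serves both polynomials, so their quotient is unchanged. *)
Lemma common_integral_multiple (p q : {poly rat}) :
  exists (c : rat) (p' q' : {poly int}),
    [/\ c != 0, pZtoQ p' = c *: p & pZtoQ q' = c *: q].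
Proof.
have [p' [a a0 ->]] := rat_poly_scale p; have [q' [b b0 ->]] := rat_poly_scale q.
exists (a%:~R * b%:~R), (b *: p'), (a *: q'); split.
- by rewrite mulf_neq0 ?intr_eq0.
- by rewrite map_polyZ/= scalerA mulrAC mulfV ?intr_eq0// mul1r.
- by rewrite map_polyZ/= scalerA mulfK ?intr_eq0.
Qed.

(** * Growth of values along the points [b ^ (d ^ m)] *)

Section IntegerPoint.
Variables (R : realType) (b : int) (d : nat).
Hypotheses (b_ge2 : 2 <= `|b|) (d_ge2 : (2 <= d)%N).

Let y (m : nat) : R := b%:~R ^+ (d ^ m).
Let T (m : nat) : R := (d ^ m)%:R * ln `|b%:~R|.

Lemma normb_ge2 : 2 <= `|b%:~R : R|.
Proof. by rewrite -intr_norm (ler_int R 2). Qed.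

Lemma point_neq0 m : y m != 0.
Proof. by rewrite expf_neq0// -normr_gt0 (lt_le_trans _ normb_ge2). Qed.

Lemma pointS m : y m.+1 = y m ^+ d.
Proof. by rewrite /y expnSr exprM. Qed.

Lemma ln_point m : ln `|y m| = T m.
Proof.
rewrite normrX lnXn; first by rewrite /T mulr_natl.
by apply: lt_le_trans normb_ge2.
Qed.

Lemma log_scale_gt0 m : 0 < T m.
Proof.
rewrite mulr_gt0 ?ltr0n ?expn_gt0//; first by rewrite (leq_trans _ d_ge2).
by rewrite ln_gt0// (lt_le_trans _ normb_ge2)// ltr1n.
Qed.

Lemma log_scaleS m : T m.+1 = d%:R * T m.
Proof. by rewrite /T expnS natrM mulrA. Qed.

Lemma point_ge m : `|b%:~R| <= `|y m|.
Proof.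
rewrite normrX -[leLHS]expr1 ler_eXn2l ?expn_gt0 ?(leq_trans _ d_ge2)//.
by rewrite (lt_le_trans _ normb_ge2)// ltr1n.
Qed.

Lemma point_pinfty : (fun m => `|y m|) @ \oo --> +oo.
Proof.
apply/cvgryPge => A; exists (Num.bound `|A|) => // m /= Am.
apply: le_trans (ler_norm A) _; apply: le_trans (ltW (archi_boundP _)) _ => //.
apply: (@le_trans _ _ ((2 ^ d ^ m)%N%:R)).
  rewrite ler_nat (leq_trans Am)// ltnW// (ltn_trans (ltn_expl m d_ge2))//.
  exact: ltn_expl.
rewrite natrX normrX lerXn2r ?nnegrE//; exact: normb_ge2.
Qed.

Lemma log_scale_pinfty : T @ \oo --> +oo.
Proof.
rewrite (_ : T = fun m => ln `|y m|); last by apply/funext => m; rewrite ln_point.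
exact: cvg_ln_pinfty point_pinfty.
Qed.

Lemma cvg_ln_value g (v : R^nat) (N : int) : has_degree g N ->
  (forall m, has_value g (y m) (v m)) ->
  (\forall m \near \oo, v m != 0) /\
  (fun m => ln `|v m| / T m) @ \oo --> (N%:~R : R).
Proof.
move=> gN gv.
have [v0] := value_growth (point_neq0 0) gN (gv 0) point_pinfty gv.
by under eq_fun do rewrite ln_point.
Qed.

Lemma horner_pZtoQ (p : {poly int}) m :
  (map_poly ratr (pZtoQ p)).[y m] = (p.[b ^+ (d ^ m)])%:~R.
Proof.
rewrite -map_poly_comp/= (eq_map_poly (g := intr)) => [|i]; last exact: ratr_int.
by rewrite /y -rmorphXn/= horner_map.
Qed.

Lemma cvg_ln_int_poly (p : {poly int}) : p != 0 ->
  (\forall m \near \oo, (p.[b ^+ (d ^ m)])%:~R != 0 :> R) /\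
  (fun m => ln `|(p.[b ^+ (d ^ m)])%:~R : R| / T m) @ \oo --> ((size p).-1%:R : R).
Proof.
move=> p0; have pQ0 : pZtoQ p != 0 by rewrite map_poly_eq0_id0// intr_eq0 lead_coef_eq0.
have := @cvg_ln_value (poly_laurent (pZtoQ p))
  (fun m => (p.[b ^+ (d ^ m)])%:~R) _ (has_degree_poly pQ0).
rewrite size_map_inj_poly//; last exact: intr_inj.
by apply=> m; rewrite -horner_pZtoQ; apply: has_value_poly; exact: point_neq0.
Qed.

Lemma cvg_ln_int_poly_prod (p : {poly int}) :
  (forall m, p.[b ^+ (d ^ m)] != 0) ->
  (fun m => ln `|(\prod_(t < m) p.[b ^+ (d ^ t)])%:~R : R| / T m) @ \oo -->
    ((size p).-1%:R / (d%:R - 1) : R).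
Proof.
move=> pn0; have p0 : p != 0 by apply: contraNneq (pn0 0%N) => ->; rewrite horner0.
have [_ pT] := cvg_ln_int_poly p0.
under eq_fun => m.
  have -> : ln `|(\prod_(t < m) p.[b ^+ (d ^ t)])%:~R : R| =
      \sum_(t < m) ln `|(p.[b ^+ (d ^ t)])%:~R : R|.
    elim: m => [|m IH]; first by rewrite !big_ord0 normr1 ln1.
    rewrite !big_ord_recr/= -IH intrM normrM lnM// posrE normr_gt0 intr_eq0//.
    by apply/prodf_neq0.
  over.
exact: cvg_geometric_sum d_ge2 log_scale_gt0 log_scaleS pT.
Qed.

End IntegerPoint.

Theorem theorem2 (R : realType) (d : nat) (A B : {poly rat}) (f : laurent rat)
    (p q : nat -> {poly rat}) (b : int)
    (d_ge2 : (2 <= d)%N)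
    (B_neq0 : B != 0)
    (f_not_rational : ~ is_rational_function f)
    (f_mahler : f = poly_laurent A / poly_laurent B * lsubst f d)
    (pq_convergents : forall k, is_reduced_convergent f k (p k) (q k))
    (b_ge2 : 2 <= `|b|)
    (b_domain : in_convergence_domain f (b%:~R : R))
    (AB_neq0 : forall m : nat,
       A.[b%:~R ^+ (d ^ m)] * B.[b%:~R ^+ (d ^ m)] != 0) :
  irrationality_exponent (lvalue f (b%:~R : R)) =
  (1 + limn_esup (fun k : nat =>
     (((size (q k.+1)).-1%:R / (size (q k)).-1%:R : R)%:E)))%E.
Proof.
have [c [AZ [BZ [c0 AE BE]]]] := common_integral_multiple A B.
have /choice[pqZ HpqZ] k : exists pqZ : {poly int} * {poly int},
    exists2 e : rat, e != 0 & pZtoQ pqZ.1 = e *: p k /\ pZtoQ pqZ.2 = e *: q k.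
  have [e [pZ [qZ [e0 pE qE]]]] := common_integral_multiple (p k) (q k).
  by exists (pZ, qZ), e.
have [rho [rho0 rhob f_cvg]] := b_domain.
pose y m : R := b%:~R ^+ (d ^ m).
(* The series converges at every [y m], since [|y m| >= |b| > rho]. *)
have fv m : has_value f (y m) (lvalue f (y m)).
  by apply/lvalueP/f_cvg/(lt_le_trans rhob)/point_ge.
have AB m : AZ.[b ^+ (d ^ m)] != 0 /\ BZ.[b ^+ (d ^ m)] != 0.
  have scaled (r : {poly rat}) (rZ : {poly int}) : pZtoQ rZ = c *: r ->
      r.[b%:~R ^+ (d ^ m)] != 0 -> rZ.[b ^+ (d ^ m)] != 0.
    move=> rE r0; rewrite -(intr_eq0 rat) -horner_map/= rE hornerZ rmorphXn/=.
    by rewrite mulf_neq0.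
  by have := AB_neq0 m; rewrite mulf_eq0 negb_or => /andP[A0 B0];
    split; [exact: scaled AE A0|exact: scaled BE B0].
(* The denominator is cleared because values are computed only for polynomial multiples and
   substitutions. *)
have mahler : poly_laurent (pZtoQ BZ) * f = poly_laurent (pZtoQ AZ) * lsubst f d.
  have cancelD (F : fieldType) (s t r w : F) :
      t != 0 -> s * t * (r / t * w) = s * r * w by move=> t0; field.
  have BE' : poly_laurent (c *: B) = poly_laurent c%:P * poly_laurent B.
    by rewrite -mul_polyC rmorphM.
  have AE' : poly_laurent (c *: A) = poly_laurent c%:P * poly_laurent A.
    by rewrite -mul_polyC rmorphM.
  rewrite AE BE AE' BE' {1}f_mahler cancelD//.
  by rewrite poly_laurent_eq0.
have step m : (BZ.[b ^+ (d ^ m)])%:~R * lvalue f (y m) =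
    (AZ.[b ^+ (d ^ m)])%:~R * lvalue f (y m.+1).
  have ym0 : y m != 0 by exact: point_neq0.
  (* Both sides are values at [y m] of the same series, the right one because
     [y m.+1 = y m ^+ d]. *)
  apply: (@has_value_uniq _ (poly_laurent (pZtoQ BZ) * f) (y m)).
    by rewrite -horner_pZtoQ; exact: has_valuepM.
  rewrite mahler -horner_pZtoQ; apply: has_valuepM => //.
  by apply: has_value_lsubst; [exact: leq_trans d_ge2|rewrite /y -pointS; exact: fv].
have iter_step m : (\prod_(t < m) BZ.[b ^+ (d ^ t)])%:~R * lvalue f (y 0) =
    (\prod_(t < m) AZ.[b ^+ (d ^ t)])%:~R * lvalue f (y m).
  elim: m => [|m IH]; first by rewrite !big_ord0 !mul1r.
  by rewrite !big_ord_recr/= !intrM mulrAC IH mulrAC -mulrA step mulrA.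
have y0 : y 0 = b%:~R by rewrite /y expn0 expr1.
rewrite -y0.
have degq k : (size (q k)).-1 = cf_degree f k.
  by have [] := reduced_convergentP f_not_rational (pq_convergents k).
have d1 : (0 : R) <= d%:R - 1 by rewrite subr_ge0 ler1n (leq_trans _ d_ge2).
(* With [p_k], [q_k], [A], [B] scaled to integer coefficients, [P = p_k(y_m) * prod A] and
   [Q = q_k(y_m) * prod B]; the iterated equation gives [Q xi - P = prod A * (q_k(y_m) f(y_m) -
   p_k(y_m))]. *)
rewrite (@exponent_limn_esup R (lvalue f (y 0)) d (cf_degree f)
  ((size AZ).-1%:R / (d%:R - 1)) ((size BZ).-1%:R / (d%:R - 1))
  (fun m => (d ^ m)%:R * ln `|b%:~R|)
  (fun k m => (pqZ k).1.[b ^+ (d ^ m)] * \prod_(t < m) AZ.[b ^+ (d ^ t)])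
  (fun k m => (pqZ k).2.[b ^+ (d ^ m)] * \prod_(t < m) BZ.[b ^+ (d ^ t)])).
- by congr (1 + limn_esup _)%E; apply/funext => k; rewrite !degq.
- by move=> k; exact: cf_degree_lt.
- by rewrite divr_ge0.
- by rewrite divr_ge0.
- exact: log_scale_gt0.
- exact: log_scale_pinfty.
- exact: log_scaleS.
(* Growth of [Q]: the value of [q_k] contributes its degree and the product of values of [B]
   contributes [beta]. *)
- move=> k; have [e e0 [_ qE]] := HpqZ k.
  have [qk0 _ _] := pq_convergents k.
  have qZ0 : (pqZ k).2 != 0.
    apply: contraNneq qk0 => qZ0; move/eqP: qE.
    by rewrite qZ0 raddf0 eq_sym scaler_eq0 (negPf e0).
  have [qn0 qlim] := cvg_ln_int_poly R b_ge2 d_ge2 qZ0.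
  have Blim := @cvg_ln_int_poly_prod R _ _ b_ge2 d_ge2 BZ (fun m => (AB m).2).
  have dE : (size (pqZ k).2).-1 = cf_degree f k.
    by rewrite -degq -(size_scale (q k) e0) -qE size_map_inj_poly//; exact: intr_inj.
  rewrite -dE; apply: (cvg_trans _ (cvgD qlim Blim)); apply: near_eq_cvg.
  apply: filterS qn0 => m qm0.
  rewrite /= -mulrDl intrM normrM lnM ?posrE ?normr_gt0// intr_eq0.
  by apply/prodf_neq0 => t _; exact: (AB t).2.
(* Size of [Q xi - P]: the product of values of [A] contributes [alpha], and the degree of
   [q_k f - p_k] contributes [- d_(k+1)]. *)
- move=> k; have [e e0 [pE qE]] := HpqZ k.
  pose g := poly_laurent (pZtoQ (pqZ k).2) * f - poly_laurent (pZtoQ (pqZ k).1).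
  have gdeg : has_degree g (- (cf_degree f k.+1)%:Z).
    have [_ gk] := reduced_convergentP f_not_rational (pq_convergents k).
    have dc : has_degree (poly_laurent e%:P) 0.
      have := @has_degree_poly _ e%:P; rewrite polyC_eq0 => /(_ e0).
      by rewrite size_polyC e0.
    have := has_degreeM dc gk; rewrite add0r mulrBr mulrA -!rmorphM/=.
    by rewrite !mul_polyC -pE -qE.
  pose v m : R := (pqZ k).2.[b ^+ (d ^ m)]%:~R * lvalue f (y m) -
    (pqZ k).1.[b ^+ (d ^ m)]%:~R.
  have gv m : has_value g (y m) (v m).
    have ym0 : y m != 0 by exact: point_neq0.
    rewrite /v -!horner_pZtoQ; apply: has_valueD; first exact: has_valuepM.
    have := @has_value_poly R (- pZtoQ (pqZ k).1) _ ym0.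
    by rewrite [poly_laurent _]raddfN [map_poly ratr _]raddfN hornerN.
  have [vn0 vlim] := cvg_ln_value b_ge2 d_ge2 gdeg gv.
  have Alim := @cvg_ln_int_poly_prod R _ _ b_ge2 d_ge2 AZ (fun m => (AB m).1).
  rewrite mulrNz in vlim; apply: (cvg_trans _ (cvgD Alim vlim)).
  apply: near_eq_cvg; apply: filterS vn0 => m vm0.
  rewrite /= -mulrDl; congr (_ / _).
  have -> : ((pqZ k).2.[b ^+ (d ^ m)] * \prod_(t < m) BZ.[b ^+ (d ^ t)])%:~R *
      lvalue f (y 0) - ((pqZ k).1.[b ^+ (d ^ m)] * \prod_(t < m) AZ.[b ^+ (d ^ t)])%:~R =
      (\prod_(t < m) AZ.[b ^+ (d ^ t)])%:~R * v m.
    by rewrite !intrM -mulrA iter_step /v; ring.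
  rewrite normrM lnM ?posrE ?normr_gt0// intr_eq0.
  by apply/prodf_neq0 => t _; exact: (AB t).1.
Qed.
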